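(* Let $p,q\ge 2$ be two multiplicatively independent integers. Then the set of all measures $\mu\in\mathcal{P}_{p,c}(\mathbb{T})$ such that $T_{q^n}\mu$ does not converge $w^*$ to $\mathrm{Leb}$ as $n\to+\infty$, and such that $T_{q^n}\mu$ converges $w^*$ to $\mathrm{Leb}$ along a sequence of upper density $1$, is residual in $(\mathcal{P}_p(\mathbb{T}),w^* )$.
   Context: Integers $p,q\ge2$ are multiplicatively independent if $\log p/\log q\notin\mathbb{Q}$. $\mathbb{T}=\mathbb{R}/\mathbb{Z}$ is the circle group. For an integer $n\ge 1$, $T_n:\mathbb{T}\to\mathbb{T}$ is $x\mapsto nx \bmod 1$, and $T_n\mu$ is the push-forward measure $T_n\mu(C)=\mu(T_n^{-1}C)$. $\mathcal{P}(\mathbb{T})$ is the set of Borel probability measures on $\mathbb{T}$ with the topology of $w^*$-convergence ($\mu_k\to\mu$ iff $\int f\,d\mu_k\to\int f\,d\mu$ for all continuous $f$ on $\mathbb{T}$). $\mathcal{P}_p(\mathbb{T})$ is the set of $\mu\in\mathcal{P}(\mathbb{T})$ with $T_p\mu=\mu$, with the induced topology (a compact metrizable space), and $\mathcal{P}_{p,c}(\mathbb{T})$ is the set of those $\mu\in\mathcal{P}_p(\mathbb{T})$ which have no atom. $\mathrm{Leb}$ is the normalised Lebesgue measure on $\mathbb{T}$. A sequence $(\nu_n)$ of measures converges to $\nu$ along a sequence of upper density $1$ if for every neighbourhood $\mathcal{V}$ of $\nu$ in $\mathcal{P}(\mathbb{T})$, $\limsup_{N\to+\infty}\frac1N\#\{1\le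 n\le N:\nu_n\in\mathcal{V}\}=1$. A subset of a Polish space is residual if it contains a dense $G_\delta$ set. *)

(* Defs.v *)
From HB Require Import structures.
From mathcomp Require Import all_boot all_order all_algebra.
From mathcomp Require Import ring_quotient.
From mathcomp Require Import all_classical all_reals all_analysis.
From mathcomp Require Import measurable_realfun borel_hierarchy.

Set Implicit Arguments.
Unset Strict Implicit.
Unset Printing Implicit Defensive.

Import Order.TTheory GRing.Theory Num.Theory.
Import numFieldNormedType.Exports.

Local Open Scope classical_set_scope.
Local Open Scope ring_scope.
Local Open Scope quotient_scope.

(* The additive group R/Z; [Num.int_num_subdef] is the predicate underlying
   [Num.int]. *)
Definition circle (R : realType) : Type :=
  Quotient.quot ((Num.int_num_subdef : {pred R}) : zmodClosed R).

HB.instance Definition _ (R : realType) := GRing.Zmodule.on (circle R).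
HB.instance Definition _ (R : realType) := Quotient.on (circle R).
HB.instance Definition _ (R : realType) := isPointed.Build (circle R) 0.

Section circle_topology.
Variable R : realType.

(* The quotient topology. [quotient_topology] cannot be copied here because it
   comes with a choice structure other than that of the quotient group. *)
Definition circle_open : set_system (circle R) :=
  fun U => open (\pi_(circle R) @^-1` U : set R).

Let circle_openT : circle_open setT.
Proof. by rewrite /circle_open preimage_setT; exact: openT. Qed.

Let circle_openI (A B : set (circle R)) :
  circle_open A -> circle_open B -> circle_open (A `&` B).
Proof. exact: openI. Qed.

Let circle_open_bigU (I : Type) (f : I -> set (circle R)) :
  (forall i, circle_open (f i)) -> circle_open (\bigcup_i f i).
Proof. by move=> fo; apply: bigcup_open => i _; exact: fo. Qed.

HB.instance Definition _ := isOpenTopological.Build (circle R)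
  circle_openT circle_openI circle_open_bigU.

End circle_topology.

Definition circle_display : measure_display.
Proof. exact: default_measure_display. Qed.

HB.instance Definition _ (R : realType) :=
  @isMeasurable.Build circle_display (circle R) <<s (@open (circle R)) >>
    (@sigma_algebra0 _ setT _) (@sigma_algebraC _ _)
    (@sigma_algebra_bigcup _ setT _).

Section circle_maps.
Variable R : realType.

Definition circle_proj (x : measurableTypeR R) : circle R := \pi_(circle R) x.

Lemma circle_proj_continuous : continuous circle_proj.
Proof. exact/continuousP. Qed.

Lemma circle_proj_measurable :
  measurable_fun [set: measurableTypeR R] circle_proj.
Proof.
apply: (measurability (@open (circle R))) => //.
by move=> _ [A oA <-]; rewrite setTI; exact: open_measurable.
Qed.

HB.instance Definition _ := isMeasurableFun.Build _ _
  (measurableTypeR R) (circle R) circle_proj circle_proj_measurable.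

(* The map T_n : x |-> nx mod 1. *)
Definition circle_times (n : nat) (x : circle R) : circle R := x *+ n.

Lemma circle_times_proj n x :
  circle_times n (circle_proj x) = circle_proj (x *+ n).
Proof.
rewrite /circle_times /circle_proj.
elim: n => [|n IHn]; first by rewrite !mulr0n !piE.
by rewrite !mulrS IHn !piE.
Qed.

Lemma circle_times_continuous n : continuous (circle_times n).
Proof.
apply/continuousP => A oA; rewrite /open/= /circle_open.
have -> : \pi_(circle R) @^-1` (circle_times n @^-1` A) =
          (fun x : R => x *+ n) @^-1` (\pi_(circle R) @^-1` A).
  by apply/seteqP; split => x /=; rewrite circle_times_proj.
have /continuousP : continuous (fun x : R => x *+ n).
  move=> x; rewrite (_ : (fun x : R => x *+ n) = (fun x => n%:R * x)).
    exact: mulrl_continuous.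
  by apply/funext => y; rewrite mulr_natl.
exact.
Qed.

Lemma circle_times_measurable n :
  measurable_fun [set: circle R] (circle_times n).
Proof.
apply: (measurability (@open (circle R))) => //.
move=> _ [A oA <-]; rewrite setTI; apply: sub_sigma_algebra.
by move/continuousP : (@circle_times_continuous n); exact.
Qed.

HB.instance Definition _ n :=
  isMeasurableFun.Build _ _ _ _ (circle_times n) (@circle_times_measurable n).

End circle_maps.

Section circle_prob.
Variable R : realType.

(* Elements are functions on all subsets of the circle, so two of them may
   agree on every Borel set without being equal. Such a pair is topologically
   indistinguishable below, and nothing below depends on the value of a measure
   at a non-Borel set. *)
Definition circle_prob : Type := probability (circle R) R.

HB.instance Definition _ := Choice.on circle_prob.

Definition integrals (mu : circle_prob) :
    {ptws continuousType (circle R) R -> R} :=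
  fun f => \int[mu]_x f x.

(* The coarsest topology for which all the maps mu |-> \int f dmu, f continuous
   on the circle, are continuous, that is, the w*-topology; see
   [cvg_circle_prob]. *)
HB.instance Definition _ :=
  Topological.copy circle_prob (initial_topology integrals).

Lemma cvg_circle_prob (F : set_system circle_prob) (mu : circle_prob) :
  Filter F ->
  F --> mu <-> forall f : continuousType (circle R) R,
    \int[nu]_x f x @[nu --> F] --> \int[mu]_x f x.
Proof.
move=> FF; split => [Fmu f|FI].
  apply: (@cvg_comp _ _ _ integrals (fun g => g f) _ _ _ _ _).
    exact: cvg_trans (cvg_app _ Fmu) (@initial_continuous _ _ integrals mu).
  exact: (@proj_continuous _ (fun=> R) f).
have FI' : integrals @ F --> integrals mu.
  apply/cvg_sup => f V [_ [[B oB <-] Bmu BV]].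
  apply: (@filterS _ F _ _ _ _ (FI f B _)); last exact: open_nbhs_nbhs.
  by move=> nu Bnu; exact: BV.
move=> V [_ [[B oB <-] Bmu BV]].
apply: (@filterS _ F _ _ _ BV); apply: FI'; exact: open_nbhs_nbhs.
Qed.

Definition circle_push (n : nat) (mu : circle_prob) : circle_prob :=
  distribution mu (@circle_times R n).

Definition unit_lebesgue : set (measurableTypeR R) -> \bar R :=
  mrestr lebesgue_measure (measurable_itv `[0%R, 1%R[).

HB.instance Definition _ := Measure.on unit_lebesgue.

Lemma unit_lebesgueT : unit_lebesgue setT = 1%E.
Proof.
rewrite /unit_lebesgue /mrestr setTI /= lebesgue_measure_itv/= lte01 oppr0.
by rewrite adde0.
Qed.

HB.instance Definition _ :=
  Measure_isProbability.Build _ _ _ unit_lebesgue unit_lebesgueT.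

Definition Leb : circle_prob := distribution unit_lebesgue (@circle_proj R).

Definition invariant_prob (p : nat) : set circle_prob :=
  [set mu | forall A, measurable A -> circle_push p mu A = mu A].

Definition atomless (mu : circle_prob) := forall x, mu [set x] = 0%E.

End circle_prob.
Arguments invariant_prob R p : clear implicits.

(* The term of index N = 0 is 0 / 0 = 0; it does not affect the limsup. *)
Definition cvg_upper_density1 (R : realType) (X : topologicalType)
    (u : nat -> X) (l : X) :=
  forall V : set X, nbhs l V ->
    limn_esup (fun N : nat =>
      ((count (fun n => u n \in V) (index_iota 1 N.+1))%:R / N%:R : R)%:E)
    = 1%E.

Definition residual (X : topologicalType) (A : set X) :=
  exists2 G : set X, Gdelta G /\ dense G & G `<=` A.

Definition mult_independent (R : realType) (p q : nat) :=
  irrational (ln p%:R / ln q%:R : R).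

(* Main.v *)
Require Import Defs.
From HB Require Import structures.
From mathcomp Require Import all_boot all_order all_algebra.
From mathcomp Require Import all_classical all_reals all_analysis.
From mathcomp Require Import measurable_realfun.
From mathcomp Require Import complex.
From mathcomp Require Import ring lra zify.

Set Implicit Arguments.
Unset Strict Implicit.
Unset Printing Implicit Defensive.

Import Order.TTheory GRing.Theory Num.Theory.
Import numFieldNormedType.Exports.

Local Open Scope classical_set_scope.
Local Open Scope ring_scope.

(** For a probability measure mu on the circle let C_a and S_a be the integrals of
cos (2 pi a x) and sin (2 pi a x).  Since T_n multiplies frequencies by n, the
coefficients of T_{q^n} mu are those of mu at the frequencies a q^n.

The set of the theorem contains the intersection of countably many open sets of
invariant measures: [not_Lebesgue], where some C_a with a > 0 does not vanish;
[recurrent q k], where some n >= k brings every C_{a q^n}, a <= k, back to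
within 1/(k+1) of C_a; and [equidistributed q k], where for some N > k all but
a fraction 1/(k+1) of the n <= N make the coefficients of T_{q^n} mu of
frequencies 1, ..., k smaller than 1/(k+1).
If mu is equidistributed for every k, then T_{q^n} mu converges to Lebesgue
measure along a sequence of upper density 1, because every weak neighbourhood
of Lebesgue measure contains all the measures whose coefficients up to some
order k are small ([fourier_small_nbhs]); and mu has no atom, because an atom
keeps at least its mass under push-forward while small coefficients allow only
small atoms ([fourier_small_atom]).  If mu is recurrent for every k, then the
convergence of T_{q^n} mu to Lebesgue measure would force C_a = 0 for every
a > 0 ([not_cvg_Lebesgue]).

The space of invariant measures is compact ([circle_prob_compact]) and regular,
hence a Baire space, so it remains to see that each of these open sets is
dense.  Near a given invariant measure nu, invariant measures are obtained as
follows ([grid_measure]).  For L large let m divide p^L - 1, with m at least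
p^(L-1).  Replace a nu-random point by the point of the grid (1/m)Z just below
it, add an offset of size O(p^-L), and average the images of the result under
the first L iterates of T_p.  The average is invariant as soon as T_p^L
permutes the offsets, because it fixes the grid; and it is close to nu, because
the first L iterates of a point and of its perturbation stay close, the last few
excepted.

With zero offsets and m prime to q, the average is carried by the grid.
Therefore C_m = 1, and T_{q^n} preserves the average whenever q^n = 1 mod m
([exists_rational_measure]).

For equidistribution the offset is the sum of the xi_i Q^i / (Q^K - 1), i < K,
where Q = p^L and the xi_i are independent uniform digits below P;
multiplication by Q rotates the digits.  The Fourier transform of the offset is
a product over i, whose factor at the frequency t is small if P is large,
unless t Q^i / (Q^K - 1) is close to an integer.  For a frequency t = t0 q^n
choose i such that s = t Q^i / (Q^K - 1) lies in [1, Q[.  Modulo 1, the logarithm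
of s in base Q is n ln q / ln Q plus a constant.  This is an orbit of an
irrational rotation, because p and q are multiplicatively independent.  Hence
the frequency of the n for which s is within d of an integer is at most a
constant times the length of the set of the logarithms in base Q of such numbers
s.  The part of this set due to an integer v has length O(d / (v ln Q)), and the
sum over v <= Q is O(d), whatever Q is ([near_int_detect]).  Because of this
uniformity P can be fixed before L, as the smallness of the offset, which is
O(P / p^L), demands.  It follows that the Fourier coefficients are small for
most n ([digit_fourier_power_sum], [exists_equidistributed_measure]). *)

(** * Integrals of bounded measurable functions *)

Section mean.
Context d (T : measurableType d) (R : realType).
Implicit Types (mu : probability T R) (f g : T -> R).

Definition bounded_mfun f :=
  measurable_fun [set: T] f /\ exists M, forall x, `|f x| <= M.

Lemma bounded_mfun_integrable mu f : bounded_mfun f ->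
  mu.-integrable setT (EFin \o f).
Proof.
move=> [mf [M fM]]; apply: measurable_bounded_integrable => //.
  by rewrite -ge0_fin_numE ?fin_num_measure.
exists M; split; first exact: num_real.
by move=> N MN x _; exact: le_trans (fM x) (ltW MN).
Qed.

Lemma bounded_mfun_cst r : bounded_mfun (fun=> r).
Proof. by split; [exact: measurable_cst | exists `|r|]. Qed.

Lemma bounded_mfunD f g : bounded_mfun f -> bounded_mfun g ->
  bounded_mfun (fun x => f x + g x).
Proof.
move=> [mf [M fM]] [mg [N gN]]; split; first exact: measurable_funD.
by exists (M + N) => x; rewrite (le_trans (ler_normD _ _))// lerD.
Qed.

Lemma bounded_mfunM f g : bounded_mfun f -> bounded_mfun g ->
  bounded_mfun (fun x => f x * g x).
Proof.
move=> [mf [M fM]] [mg [N gN]]; split; first exact: measurable_funM.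
by exists (M * N) => x; rewrite normrM ler_pM.
Qed.

Lemma bounded_mfunZ r f : bounded_mfun f -> bounded_mfun (fun x => r * f x).
Proof. by apply: bounded_mfunM; exact: bounded_mfun_cst. Qed.

Lemma bounded_mfunB f g : bounded_mfun f -> bounded_mfun g ->
  bounded_mfun (fun x => f x - g x).
Proof.
move=> bf bg; have -> : (fun x => f x - g x) = (fun x => f x + -1 * g x).
  by apply/funext => x; rewrite mulN1r.
by apply: bounded_mfunD => //; exact: bounded_mfunZ.
Qed.

Lemma bounded_mfun_sum (I : Type) (r : seq I) (F : I -> T -> R) :
  (forall i, bounded_mfun (F i)) -> bounded_mfun (fun x => \sum_(i <- r) F i x).
Proof.
move=> bF; elim: r => [|i r IHr].
  under eq_fun do rewrite big_nil; exact: bounded_mfun_cst.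
by under eq_fun do rewrite big_cons; exact: bounded_mfunD.
Qed.

Lemma mean_cst mu r : \int[mu]_x r = r.
Proof. by rewrite Rintegral_cst// [X in fine X](probability_setT mu) mulr1. Qed.

Lemma meanD mu f g : bounded_mfun f -> bounded_mfun g ->
  \int[mu]_x (f x + g x) = \int[mu]_x f x + \int[mu]_x g x.
Proof. by move=> bf bg; apply: RintegralD => //; exact: bounded_mfun_integrable. Qed.

Lemma meanB mu f g : bounded_mfun f -> bounded_mfun g ->
  \int[mu]_x (f x - g x) = \int[mu]_x f x - \int[mu]_x g x.
Proof. by move=> bf bg; apply: RintegralB => //; exact: bounded_mfun_integrable. Qed.

Lemma meanZ mu r f : bounded_mfun f ->
  \int[mu]_x (r * f x) = r * \int[mu]_x f x.
Proof. by move=> bf; apply: RintegralZl => //; exact: bounded_mfun_integrable. Qed.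

Lemma mean_sum mu (I : Type) (r : seq I) (F : I -> T -> R) :
  (forall i, bounded_mfun (F i)) ->
  \int[mu]_x (\sum_(i <- r) F i x) = \sum_(i <- r) \int[mu]_x F i x.
Proof.
move=> bF; elim: r => [|i r IHr].
  by under eq_Rintegral do rewrite big_nil; rewrite mean_cst big_nil.
under eq_Rintegral do rewrite big_cons.
by rewrite big_cons meanD ?IHr//; exact: bounded_mfun_sum.
Qed.

Lemma le_mean mu f g : bounded_mfun f -> bounded_mfun g ->
  (forall x, f x <= g x) -> \int[mu]_x f x <= \int[mu]_x g x.
Proof.
by move=> bf bg fg; apply: le_Rintegral => //; exact: bounded_mfun_integrable.
Qed.

Lemma norm_mean_le mu f M : bounded_mfun f ->
  (forall x, `|f x| <= M) -> `|\int[mu]_x f x| <= M.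
Proof.
move=> bf fM; rewrite ler_norml -[X in - X]mulr1 -[X in - X](mean_cst mu).
rewrite mulr1 -[X in _ && (_ <= X)](mean_cst mu M); apply/andP; split.
  rewrite -mulN1r -meanZ; last exact: bounded_mfun_cst.
  apply: le_mean => //; first exact/bounded_mfunZ/bounded_mfun_cst.
  by move=> x; rewrite mulN1r; have := fM x; rewrite ler_norml => /andP[].
apply: le_mean => //; first exact: bounded_mfun_cst.
by move=> x; have := fM x; rewrite ler_norml => /andP[].
Qed.

Lemma norm_meanB_le mu f g e : bounded_mfun f -> bounded_mfun g ->
  (forall x, `|f x - g x| <= e) -> `|\int[mu]_x f x - \int[mu]_x g x| <= e.
Proof.
move=> bf bg fg; rewrite -meanB//; apply: norm_mean_le => //.
exact: bounded_mfunB.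
Qed.

End mean.

Lemma bounded_mfun_comp d d' (T : measurableType d) (T' : measurableType d')
    (R : realType) (h : T -> T') (f : T' -> R) :
  measurable_fun setT h -> bounded_mfun f -> bounded_mfun (f \o h).
Proof.
move=> mh [mf [M fM]]; split; first exact: measurableT_comp.
by exists M => x; exact: fM.
Qed.

Lemma mean_distribution d d' (T : measurableType d) (T' : measurableType d')
    (R : realType) (mu : probability T R) (h : {mfun T >-> T'}) (f : T' -> R) :
  bounded_mfun f -> \int[distribution mu h]_x f x = \int[mu]_x f (h x).
Proof.
move=> bf; rewrite /Rintegral integral_distribution//.
  by apply/measurable_EFinP; case: bf.
by apply: bounded_mfun_integrable; exact: bounded_mfun_comp.
Qed.

(** * The circle and its fundamental domain *)

Section lift.
Variable R : realType.
Implicit Types (c : circle R) (x : R).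

Definition circle_lift c : R := repr c - (Num.floor (repr c))%:~R.

Lemma circle_projD x y : circle_proj (x + y) = circle_proj x + circle_proj y.
Proof. by rewrite /circle_proj !piE. Qed.

Lemma circle_projMn x n : circle_proj (x *+ n) = circle_proj x *+ n.
Proof. exact/esym/circle_times_proj. Qed.

Lemma circle_proj_eq x y :
  (circle_proj x = circle_proj y) <-> (x - y \is a Num.int).
Proof.
rewrite /circle_proj; split => [/eqP|xy]; last apply/eqP.
  by rewrite piE.
by rewrite piE.
Qed.

Lemma circle_proj_int x : x \is a Num.int -> circle_proj x = 0.
Proof.
move=> xZ; have -> : 0 = circle_proj (0 : R) :> circle R.
  by rewrite /circle_proj piE.
by apply/circle_proj_eq; rewrite subr0.
Qed.

Lemma circle_liftK : cancel circle_lift (@circle_proj R).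
Proof.
move=> c; rewrite -[RHS](reprK c); apply/circle_proj_eq.
by rewrite /circle_lift addrAC subrr add0r rpredN intr_int.
Qed.

Lemma circle_lift_ge0 c : 0 <= circle_lift c.
Proof. by rewrite subr_ge0 floor_le_tmp. Qed.

Lemma circle_lift_lt1 c : circle_lift c < 1.
Proof. by have := floorD1_gt (repr c); rewrite ltrBlDl intrD. Qed.

Lemma circle_lift_proj x : 0 <= x < 1 -> circle_lift (circle_proj x) = x.
Proof.
move=> /andP[x0 x1]; have := circle_liftK (circle_proj x).
move=> /circle_proj_eq /intrP[k E].
have := circle_lift_ge0 (circle_proj x); have := circle_lift_lt1 (circle_proj x).
move=> l1 l0; suff k0 : k = 0 by move: E; rewrite k0; lra.
have kl : (k < 1)%R by rewrite -(ltr_int R) -E; lra.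
have kg : (-1 < k)%R by rewrite -(ltr_int R) rmorphN1 -E; lra.
by move: kl kg; clear; lia.
Qed.

Lemma circle_lift_projE x :
  circle_lift (circle_proj x) = x - (Num.floor x)%:~R.
Proof.
have -> : circle_proj x = circle_proj (x - (Num.floor x)%:~R).
  by apply/circle_proj_eq; rewrite opprB addrC subrK intr_int.
apply: circle_lift_proj; rewrite subr_ge0 floor_le_tmp/=.
by have := floorD1_gt x; rewrite ltrBlDl intrD.
Qed.

End lift.

(** Only [x] is confined to the segment: when the segment contains a period of
[g], the point [y] may fall just outside of it. *)
Lemma segment_unif_continuous (R : realType) (g : R -> R) (a b e : R) :
  continuous g -> 0 < e -> exists2 d, 0 < d &
    forall x y, a <= x <= b -> `|x - y| < d -> `|g x - g y| < e.
Proof.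
move=> cg e0; have /compact_near_coveringP cov := @segment_compact R a b.
have := cov _ (0^'+) (fun d x => forall y, `|x - y| < d -> `|g x - g y| < e) _.
case=> [x _|d /= d0 dP].
  have /cvgrPdist_lt/(_ (e / 2) (divr_gt0 e0 (ltr0Sn R 1))) := cg x.
  case=> r /= r0 rP; exists (ball x (r / 2), [set d | 0 < d < r / 2]) => /=.
    split; first by apply: nbhsx_ballx; rewrite divr_gt0.
    by exists (r / 2) => /=; rewrite ?divr_gt0// => z /=; rewrite sub0r normrN => + z0;
      rewrite gtr0_norm// z0 => ->.
  move=> [x' d] /= [x'x /andP[d0 dr]] y x'y.
  have xx' : `|x - x'| < r by apply: lt_trans x'x _; rewrite ltr_pdivrMr// ltr_pMr// ltr1n.
  have xy : `|x - y| < r.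
    rewrite (splitr r) -(subrKA x') (le_lt_trans (ler_normD _ _))// ltrD//.
    exact: lt_trans x'y dr.
  rewrite (splitr e) -(subrKA (g x)) (le_lt_trans (ler_normD _ _))// ltrD//.
    by rewrite distrC; exact: rP.
  exact: rP.
exists (d / 2); first by rewrite divr_gt0.
have d2 : 0 < d / 2 by rewrite divr_gt0.
have dd : `|0 - d / 2| < d.
  by rewrite sub0r normrN gtr0_norm// ltr_pdivrMr// ltr_pMr// ltr1n.
by move=> x y abx xy; exact: (dP (d / 2)).
Qed.

Section circle_functions.
Variable R : realType.
Implicit Types (c : circle R) (x : R).

Lemma circle_continuous (T : topologicalType) (f : circle R -> T) :
  continuous (f \o @circle_proj R) -> continuous f.
Proof.
move=> /continuousP cf; apply/continuousP => A oA.
exact: cf.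
Qed.

Lemma circle_continuousT c : continuous (fun x : circle R => x + c).
Proof.
apply: circle_continuous => x.
rewrite -(circle_liftK c) /comp.
under eq_fun do rewrite -circle_projD.
apply: (@continuous_comp _ _ _ (fun y : R => y + circle_lift c)).
  by apply: cvgD; [exact: cvg_id|exact: cvg_cst].
exact: circle_proj_continuous.
Qed.

Lemma continuous_circle_measurable (f : circle R -> circle R) :
  continuous f -> measurable_fun setT f.
Proof.
move=> /continuousP cf; apply: (measurability (@open (circle R))) => //.
move=> _ [A oA <-]; rewrite setTI; apply: sub_sigma_algebra; exact: cf.
Qed.

(** The lift jumps at 0 but is lower semicontinuous: for x >= 0 the preimage
of ]x, +oo[ corresponds on the line to the union of the open intervals
]n + x, n + 1[. *)
Lemma measurable_circle_lift : measurable_fun [set: circle R] (@circle_lift R).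
Proof.
apply: (measurability _ (RGenOInfty.measurableE R)).
move=> _ [_ [x ->] <-]; rewrite setTI; have [x0|x0] := ltP x 0.
  rewrite (_ : _ @^-1` _ = setT)//; apply/seteqP; split=> // c _ /=.
  by rewrite in_itv/= andbT (lt_le_trans x0)// circle_lift_ge0.
apply: sub_sigma_algebra; rewrite /open/= /circle_open.
rewrite (_ : _ @^-1` _ = \bigcup_(n in [set: int]) [set` `](n%:~R + x)%R, (n%:~R + 1)%R[]).
  by apply: bigcup_open => n _; exact: itv_open.
apply/seteqP; split => [y /=|y [n _] /=]; rewrite !in_itv/= ?andbT.
  rewrite -/(circle_proj y) circle_lift_projE => xy.
  exists (Num.floor y) => //=; rewrite in_itv/= -ltrBrDl xy.
  by have := floorD1_gt y; rewrite intrD.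
move=> /andP[ny yn]; rewrite -/(circle_proj y) circle_lift_projE.
rewrite (_ : Num.floor y = n) ?ltrBrDl//.
by apply: floor_def; rewrite intrD yn (le_trans _ (ltW ny))// lerDl.
Qed.

Lemma measurable_circle1 c : measurable [set c].
Proof.
rewrite (_ : [set c] = @circle_lift R @^-1` [set circle_lift c]).
  by rewrite -[X in measurable X]setTI; exact: measurable_circle_lift.
apply/seteqP; split => [_ -> //|c' /= cc'].
by rewrite -(circle_liftK c') cc' circle_liftK.
Qed.

Lemma continuous_circle_bounded_mfun (f : circle R -> R) :
  continuous f -> bounded_mfun f.
Proof.
move=> cf; have cfp : continuous (f \o @circle_proj R).
  by move=> x; apply: continuous_comp; [exact: circle_proj_continuous|exact: cf].
split.
  have -> : f = (f \o @circle_proj R) \o @circle_lift R.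
    by apply/funext => c /=; rewrite circle_liftK.
  apply: measurableT_comp; last exact: measurable_circle_lift.
  exact: continuous_measurable_fun.
have [z _ zP] : exists2 z : R, z \in `[0, 1] &
    forall t : R, t \in `[0, 1] -> `|f (circle_proj t)| <= `|f (circle_proj z)|.
  apply: (@EVT_max _ (fun t => `|f (circle_proj t)|)) => //.
  by apply: continuous_subspaceT => x; apply: cvg_norm; exact: cfp.
exists `|f (circle_proj z)| => c; rewrite -(circle_liftK c); apply: zP.
by rewrite in_itv/= circle_lift_ge0 ltW// circle_lift_lt1.
Qed.

End circle_functions.

(** * Weak compactness of the probability measures on the circle *)

Section riemann_stieltjes.
Variable R : realType.
Implicit Type nu : probability (measurableTypeR R) R.

Definition cdf_real nu (y : R) : R := fine (nu [set` `]-oo, y]]).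

(** Evaluated at a point, the indicator function of ]y, y'] is a difference
[a%:R - b%:R], where [a] and [b] compare the point with y' and y. *)
Lemma bool_gap (a b : bool) : 0 <= 1 - (a%:R - b%:R) :> R.
Proof. by case: a; case: b; rewrite /=; lra. Qed.

Lemma bounded_mfun_le (y : R) :
  bounded_mfun (fun t : measurableTypeR R => ((t : R) <= y)%R%:R : R).
Proof.
rewrite (_ : (fun _ => _) = \1_([set` `]-oo, y]])).
  split; first exact: measurable_indic.
  by exists 1 => t; rewrite indicE ger0_norm// lern1 leq_b1.
by apply/funext => t; rewrite indicE mem_setE in_itv.
Qed.

Lemma cdf_realE nu y : \int[nu]_t (((t : R) <= y)%R%:R : R) = cdf_real nu y.
Proof.
rewrite /cdf_real -[in RHS](setIT [set` `]-oo, y]]) -integral_indic//.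
congr fine; apply: eq_integral => t _.
by rewrite indicE mem_setE in_itv.
Qed.

(** The measure is carried by ]y 0, y m], and on the i-th piece of this
interval [g] is within [e] of [v i].  An integral is thus known up to [e] from
finitely many values of the distribution function, which is what makes it
possible to pass to a pointwise limit of distribution functions. *)
Lemma riemann_stieltjes nu (g : measurableTypeR R -> R) (m : nat)
    (y : nat -> R) (v : nat -> R) (e : R) :
  bounded_mfun g -> {homo y : i j / (i <= j)%N >-> i <= j} ->
  cdf_real nu (y 0%N) = 0 -> cdf_real nu (y m) = 1 ->
  (forall i (t : measurableTypeR R), (i < m)%N -> y i < (t : R) <= y i.+1 -> `|g t - v i| <= e) ->
  `|\int[nu]_t g t -
    \sum_(0 <= i < m) v i * (cdf_real nu (y i.+1) - cdf_real nu (y i))| <= e.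
Proof.
move=> bg ymon y0 ym gv.
pose I i (t : measurableTypeR R) : R := ((t : R) <= y i.+1)%R%:R - ((t : R) <= y i)%R%:R.
have bI i : bounded_mfun (I i) by apply: bounded_mfunB; exact: bounded_mfun_le.
have I0 i t : 0 <= I i t.
  rewrite subr_ge0 ler_nat; case: (leP (t : R) (y i)) => // ty.
  by rewrite (le_trans ty)// ymon.
have sumI t : \sum_(0 <= i < m) I i t = ((t : R) <= y m)%R%:R - ((t : R) <= y 0%N)%R%:R.
  by rewrite telescope_sumr.
(* The hypothesis on [e] is void on an empty piece, but some piece is not
   empty because the distribution function goes from 0 to 1. *)
have e0 : (0 < m)%N -> 0 <= e.
  move=> m0; have [i im yi] : exists2 i, (i < m)%N & y i < y i.+1.
    apply: contrapT => H; have : y m = y 0%N.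
      suff : forall k, (k <= m)%N -> y k = y 0%N by exact.
      elim=> // k IHk km; rewrite -IHk 1?ltnW//.
      apply/eqP; rewrite eq_le (ymon k k.+1)// andbT leNgt; apply/negP => yk.
      by apply: H; exists k.
    by move=> ym0; move: ym; rewrite ym0 y0 => /esym/eqP; rewrite oner_eq0.
  by apply: le_trans (gv i (y i.+1) im _); rewrite ?normr_ge0// yi lexx.
have [m0|{}/e0 e0] := posnP m.
  by move: ym; rewrite m0 y0 => /esym/eqP; rewrite oner_eq0.
have [_ [M gM]] := bg.
pose g1 (t : measurableTypeR R) := \sum_(0 <= i < m) g t * I i t.
have bg1 : bounded_mfun g1.
  by apply: bounded_mfun_sum => i; exact: bounded_mfunM.
(* The two functions agree on ]y 0, y m], which has full measure. *)
have gE : \int[nu]_t g t = \int[nu]_t g1 t.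
  apply/eqP; rewrite -subr_eq0 -meanB// -normr_le0.
  have bgM : bounded_mfun (fun t : measurableTypeR R =>
      M * (1 - (((t : R) <= y m)%R%:R - ((t : R) <= y 0%N)%R%:R))).
    apply/bounded_mfunZ/bounded_mfunB; first exact: bounded_mfun_cst.
    by apply: bounded_mfunB; exact: bounded_mfun_le.
  have -> : 0 = \int[nu]_t (M * (1 - (((t : R) <= y m)%R%:R - ((t : R) <= y 0%N)%R%:R))).
    rewrite meanZ; last first.
      apply/bounded_mfunB; first exact: bounded_mfun_cst.
      by apply: bounded_mfunB; exact: bounded_mfun_le.
    rewrite meanB; [|exact: bounded_mfun_cst|]; last first.
      by apply: bounded_mfunB; exact: bounded_mfun_le.
    rewrite mean_cst meanB; [|exact: bounded_mfun_le..].
    by rewrite !cdf_realE y0 ym subr0 subrr mulr0.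
  have gM' (t : measurableTypeR R) :
      `|g t - g1 t| <= M * (1 - (((t : R) <= y m)%R%:R - ((t : R) <= y 0%N)%R%:R)).
    rewrite /g1 -mulr_sumr sumI -[X in `|X - _|]mulr1 -mulrBr normrM.
    rewrite [X in _ * X <= _]ger0_norm ?ler_wpM2r//; last 2 first.
    - exact: bool_gap.
    - exact: bool_gap.
  rewrite ler_norml; apply/andP; split.
    rewrite -mulN1r -meanZ//; apply: le_mean => //.
    - exact: bounded_mfunZ.
    - exact: bounded_mfunB.
    - by move=> t; rewrite mulN1r; have := gM' t; rewrite ler_norml => /andP[].
  apply: le_mean => //; first exact: bounded_mfunB.
  by move=> t; have := gM' t; rewrite ler_norml => /andP[].
have -> : \sum_(0 <= i < m) v i * (cdf_real nu (y i.+1) - cdf_real nu (y i)) =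
    \int[nu]_t (\sum_(0 <= i < m) v i * I i t).
  rewrite mean_sum; last by move=> i; exact: bounded_mfunZ.
  apply: eq_bigr => i _; rewrite meanZ// meanB; [|exact: bounded_mfun_le..].
  by rewrite !cdf_realE.
rewrite gE; apply: norm_meanB_le => //.
  by apply: bounded_mfun_sum => i; exact: bounded_mfunZ.
move=> t; rewrite /g1 -sumrB (le_trans (ler_norm_sum _ _ _))//.
apply: (@le_trans _ _ (\sum_(0 <= i < m) e * I i t)).
  rewrite big_nat [leRHS]big_nat; apply: ler_sum => i /andP[_ im].
  rewrite -mulrBl normrM (ger0_norm (I0 i t)).
  have [ti|ti] := boolP (y i < (t : R) <= y i.+1).
    by rewrite ler_wpM2r// gv.
  suff -> : I i t = 0 by rewrite !mulr0.
  have yi := ymon i i.+1 (leqnSn i); rewrite /I.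
  move: ti; rewrite negb_and -leNgt -ltNge => /orP[ti|ti].
    by rewrite ti (le_trans ti yi) subrr.
  by rewrite !leNgt ti (le_lt_trans yi ti) subrr.
rewrite -mulr_sumr sumI ler_piMr//.
by rewrite -subr_ge0 bool_gap.
Qed.

End riemann_stieltjes.

(** The image ultrafilter has a cluster point in the segment, and an
ultrafilter converges to its cluster points. *)
Lemma ultra_bounded_cvg (R : realType) (X : Type) (F : set_system X)
    (h : X -> R) (a b : R) :
  UltraFilter F -> (forall x, a <= h x <= b) -> exists2 l, a <= l <= b & h @ F --> l.
Proof.
move=> FU hab; have PF : ProperFilter F := ultra_proper.
have := @segment_compact R a b.
move=> /(_ (h @ F)) [].
  by apply: (@filterS _ F _ setT _ _ filterT) => x _ /=; rewrite in_itv/= hab.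
move=> l [/= lab cl]; exists l; first by rewrite in_itv/= in lab.
move=> A Al; have [//|nA] := in_ultra_setVsetC (h @^-1` A) FU.
by have [y []] := cl (~` A) A nA Al.
Qed.

Section weak_compactness.
Variable R : realType.

Let lift_mfun : circle R -> measurableTypeR R := @circle_lift R.
HB.instance Definition _ := isMeasurableFun.Build _ _ _ _ lift_mfun
  (@measurable_circle_lift R).

Definition lift_prob (mu : circle_prob R) : probability (measurableTypeR R) R :=
  distribution (mu : probability _ _) lift_mfun.

Lemma mean_lift (mu : circle_prob R) (f : circle R -> R) : continuous f ->
  \int[lift_prob mu]_t f (circle_proj t) = \int[mu]_x f x.
Proof.
move=> cf; rewrite mean_distribution.
  by apply: eq_Rintegral => x _; rewrite /lift_mfun circle_liftK.
apply: (@bounded_mfun_comp _ _ _ _ _ (@circle_proj R) f).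
  exact: circle_proj_measurable.
exact: continuous_circle_bounded_mfun.
Qed.

Lemma cdf_real_ge0 (nu : probability (measurableTypeR R) R) y : 0 <= cdf_real nu y.
Proof. by rewrite fine_ge0. Qed.

Lemma cdf_real_le1 (nu : probability (measurableTypeR R) R) y : cdf_real nu y <= 1.
Proof.
by rewrite -(@fine1 R) fine_le ?fin_num_measure//; exact: probability_le1.
Qed.

Lemma le_cdf_real (nu : probability (measurableTypeR R) R) x y :
  x <= y -> cdf_real nu x <= cdf_real nu y.
Proof.
move=> xy; rewrite fine_le ?fin_num_measure//.
by rewrite le_measure ?inE//; apply/subset_itv; rewrite ?leBSide.
Qed.

Lemma cdf_liftE mu y : cdf_real (lift_prob mu) y =
  fine ((mu : probability _ _) (@circle_lift R @^-1` [set` `]-oo, y]])).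
Proof. by []. Qed.

Lemma cdf_lift_lt0 mu y : y < 0 -> cdf_real (lift_prob mu) y = 0.
Proof.
move=> y0; rewrite cdf_liftE (_ : _ @^-1` _ = set0) ?measure0//.
apply/seteqP; split=> // c; rewrite /= in_itv/= => cy.
by have := circle_lift_ge0 c; rewrite leNgt (le_lt_trans cy).
Qed.

Lemma cdf_lift_ge1 mu y : 1 <= y -> cdf_real (lift_prob mu) y = 1.
Proof.
move=> y0; rewrite cdf_liftE (_ : _ @^-1` _ = setT) ?(@probability_setT _ _ _ mu)//.
apply/seteqP; split=> // c _; rewrite /= in_itv/=.
by rewrite (le_trans _ y0)// ltW// circle_lift_lt1.
Qed.

Section right_limit.
Variable H : R -> R.
Hypotheses (H_mono : {homo H : x y / x <= y}) (H_ge0 : forall x, 0 <= H x).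

(** A pointwise limit of distribution functions is nondecreasing but may
fail to be right-continuous; its right limit at every point is the distribution
function of a measure. *)
Definition right_limit x : R := inf [set H y | y in [set y | x < y]].

Let has_inf_right x : has_inf [set H y | y in [set y | x < y]].
Proof.
split; first by exists (H (x + 1)), (x + 1) => //=; rewrite ltrDl.
by exists 0 => _ [y _ <-].
Qed.

Lemma right_limit_le x y : x < y -> right_limit x <= H y.
Proof. by move=> xy; apply: ge_inf; [case: (has_inf_right x)|exists y]. Qed.

Lemma right_limit_ge x r : (forall y, x < y -> r <= H y) -> r <= right_limit x.
Proof.
move=> rH; apply: lb_le_inf; first by case: (has_inf_right x).
by move=> _ [y /= xy <-]; exact: rH.
Qed.

Lemma right_limit_adherent x e : 0 < e -> exists2 y, x < y & H y < right_limit x + e.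
Proof.
move=> /(@inf_adherent _ _)/(_ (has_inf_right x))[_ [y /= xy <-] ye].
by exists y.
Qed.

Lemma right_limit_mono : {homo right_limit : x y / x <= y}.
Proof.
move=> x y xy; apply: right_limit_ge => z yz; apply: right_limit_le.
exact: le_lt_trans xy yz.
Qed.

Lemma right_limit_cvg x : H (x + d) @[d --> 0^'+] --> right_limit x.
Proof.
apply/cvgrPdist_le => e e0; have [y xy ye] := right_limit_adherent x e0.
exists (y - x) => /=; first by rewrite subr_gt0.
move=> d /=; rewrite sub0r normrN => dyx d0; rewrite gtr0_norm// in dyx.
have h1 : right_limit x <= H (x + d) by apply: right_limit_le; rewrite ltrDl.
have h2 : H (x + d) <= H y by apply: H_mono; lra.
by rewrite distrC ger0_norm ?subr_ge0//; lra.
Qed.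

Lemma right_limit_right_continuous : right_continuous right_limit.
Proof.
move=> x; apply/cvgrPdist_le => e e0.
have [y xy ye] := right_limit_adherent x e0.
exists (y - x) => /=; first by rewrite subr_gt0.
move=> z /= zyx xz; rewrite distrC gtr0_norm ?subr_gt0// in zyx.
have h1 : right_limit x <= right_limit z by apply: right_limit_mono; exact: ltW.
have h2 : right_limit z <= H y by apply: right_limit_le; lra.
by rewrite distrC ger0_norm ?subr_ge0//; lra.
Qed.

End right_limit.

Section limit_measure.
Variables (F : set_system (circle_prob R)) (H : R -> R).
Hypothesis FU : UltraFilter F.
Hypothesis FH : forall y, cdf_real (lift_prob mu) y @[mu --> F] --> H y.

Let PF : ProperFilter F := ultra_proper.

Let H_mono : {homo H : x y / x <= y}.
Proof.
move=> x y xy; apply: (ler_cvg_to (@FH x) (@FH y)).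
by apply: nearW => mu; exact: le_cdf_real.
Qed.

Let H_ge0 x : 0 <= H x.
Proof. by apply: cvgr_to_ge (@FH x) _; apply: nearW => mu; exact: cdf_real_ge0. Qed.

Let H_lt0 x : x < 0 -> H x = 0.
Proof.
move=> x0; apply: cvg_unique (@FH x) _; first exact: Rhausdorff.
by apply: cvg_near_cst; apply: nearW => mu; exact: cdf_lift_lt0.
Qed.

Let H_ge1 x : 1 <= x -> H x = 1.
Proof.
move=> x0; apply: cvg_unique (@FH x) _; first exact: Rhausdorff.
by apply: cvg_near_cst; apply: nearW => mu; exact: cdf_lift_ge1.
Qed.

Let C := right_limit H.

Let C_lt0 x : x < 0 -> C x = 0.
Proof.
move=> x0; apply/eqP; rewrite eq_le; apply/andP; split; last first.
  by apply: right_limit_ge => // y _; exact: H_ge0.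
have <- : H (x / 2) = 0 by apply: H_lt0; lra.
by apply: right_limit_le => //; lra.
Qed.

Let C_ge1 x : 1 <= x -> C x = 1.
Proof.
move=> x1; apply/eqP; rewrite eq_le; apply/andP; split.
  rewrite -(@H_ge1 (x + 1)); last lra.
  by apply: right_limit_le => //; lra.
by apply: right_limit_ge => // y xy; rewrite H_ge1//; lra.
Qed.

Let C_Ny : C @ -oo --> (0 : R).
Proof.
apply: cvg_near_cst; apply: filterS (nbhs_ninfty_lt (num_real 0)).
exact: C_lt0.
Qed.

Let C_y : C @ +oo --> (1 : R).
Proof.
apply: cvg_near_cst; apply: filterS (nbhs_pinfty_ge (num_real 1)).
exact: C_ge1.
Qed.

HB.instance Definition _ := isCumulative.Build R _ R C
  (right_limit_mono H_ge0) (right_limit_right_continuous H_ge0).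
HB.instance Definition _ := isCumulativeBounded.Build R 0 1 C C_Ny C_y.

Let nu : probability (measurableTypeR R) R := lebesgue_stieltjes_measure C.

Let cdf_nu y : cdf_real nu y = C y.
Proof. by rewrite /cdf_real; have := cdf_lebesgue_stieltjes_id C y; rewrite /cdf/= => ->. Qed.

(** The distribution functions converge to [H], whereas the limit measure has
distribution function [C], which is only the right limit of [H].  Integrals
against [mu] are therefore compared with sums on a subdivision shifted to the
right by a small [dl], integrals against [nu] with sums on the unshifted
subdivision. *)
Lemma cvg_limit_measure :
  exists mu0 : circle_prob R, F --> mu0.
Proof.
exists (distribution nu (@circle_proj R)).
apply/cvg_circle_prob => f.
set g := f \o @circle_proj R.
have cf : continuous f := @cts_fun _ _ f.
have cg : continuous g.
  by move=> x; apply: continuous_comp; [exact: circle_proj_continuous|exact: cf].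
have bg : bounded_mfun (g : measurableTypeR R -> R).
  apply: (@bounded_mfun_comp _ _ _ _ _ (@circle_proj R) f).
    exact: circle_proj_measurable.
  exact: continuous_circle_bounded_mfun.
rewrite mean_distribution; last exact: continuous_circle_bounded_mfun.
apply/cvgrPdist_le => e e0.
have [d d0 dP] := @segment_unif_continuous R g (- 1) 2 (e / 4) cg (divr_gt0 e0 (ltr0Sn R 3)).
have [m md] : exists m : nat, 4 / d < m.+1%:R.
  by exists (Num.truncn (4 / d)); rewrite truncnS_gt.
have m0 : 0 < m.+1%:R :> R by [].
set h : R := 2 / m.+1%:R.
have h0 : 0 < h by rewrite divr_gt0.
have hd : h < d / 2.
  rewrite /h ltr_pdivrMr//; move: md; rewrite ltr_pdivrMr//; lra.
(* The subdivision of [-1, 1] reaches below 0 and up to 1, so that the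
   distribution functions run from 0 to 1 on it even after a shift by [dl] < 1. *)
pose y (i : nat) : R := i%:R * h - 1.
have yS i : y i.+1 = y i + h by rewrite /y -natr1 mulrDl mul1r addrAC.
have y_mono : {homo y : i j / (i <= j)%N >-> i <= j}.
  by move=> i j ij; rewrite /y lerB// ler_pM2r// ler_nat.
have y0 : y 0%N = -1 by rewrite /y mul0r sub0r.
have ym : y m.+1 = 1 by rewrite /y /h mulrCA mulfV ?gt_eqF//; lra.
pose S (G : R -> R) : R := \sum_(0 <= i < m.+1) g (y i.+1) * (G (y i.+1) - G (y i)).
have gy i (t dl : R) : (i < m.+1)%N -> 0 <= dl < d / 2 ->
    y i + dl < t <= y i.+1 + dl -> `|g t - g (y i.+1)| <= e / 4.
  move=> im /andP[dl0 dld] /andP[yt ty]; rewrite distrC ltW// dP//.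
    rewrite -{1}y0 y_mono//= (@le_trans _ _ (y m.+1)) ?y_mono// ym.
    by rewrite ler1n.
  rewrite yS in ty *; rewrite ltr_norml; lra.
have Snu : `|\int[nu]_x g x - S C| <= e / 4.
  rewrite /S; under eq_bigr do rewrite -!cdf_nu.
  apply: riemann_stieltjes => //.
  - by rewrite cdf_nu y0 C_lt0// ltrN10.
  - by rewrite cdf_nu ym C_ge1.
  - by move=> i t im yt; apply: (@gy i t 0) => //; rewrite ?addr0// lexx divr_gt0.
have Smu mu dl : 0 < dl < Num.min 1 (d / 2) -> `|\int[lift_prob mu]_x g x -
    S (fun z => cdf_real (lift_prob mu) (z + dl))| <= e / 4.
  rewrite lt_min => /and3P[dl0 dl1 dld].
  apply: (@riemann_stieltjes _ (lift_prob mu) g m.+1 (fun i => y i + dl)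
      (fun i => g (y i.+1))) => //.
  - by move=> i j ij; rewrite lerD2r y_mono.
  - by rewrite y0 cdf_lift_lt0//; lra.
  - by rewrite ym cdf_lift_ge1//; lra.
  - by move=> i t im yt; apply: (@gy i t dl) => //; rewrite ltW.
have SH : S (fun z => H (z + dl)) @[dl --> 0^'+] --> S C.
  apply: cvg_big => [|i _]; first exact: add_continuous.
  by apply: cvgMr; apply: cvgB; exact: right_limit_cvg.
have [dl [dl01 dlP]] : exists dl, 0 < dl < Num.min 1 (d / 2) /\
    `|S C - S (fun z => H (z + dl))| <= e / 4.
  have /cvgrPdist_le/(_ _ (divr_gt0 e0 (ltr0Sn R 3))) := SH.
  move=> SHe; near (0 : R)^'+ => dl; exists dl; split; last by near: dl.
  apply/andP; split; first by near: dl; exact: nbhs_right_gt.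
  by near: dl; apply: nbhs_right_lt; rewrite lt_min ltr01 divr_gt0.
have SF : S (fun z => cdf_real (lift_prob mu) (z + dl)) @[mu --> F] -->
    S (fun z => H (z + dl)).
  apply: cvg_big => [|i _]; first exact: add_continuous.
  by apply: cvgMr; apply: cvgB; exact: FH.
move/cvgrPdist_le : SF => /(_ _ (divr_gt0 e0 (ltr0Sn R 3))).
apply: filterS => mu; rewrite -mean_lift//; move: (Smu mu dl dl01) Snu dlP.
rewrite !ler_norml => /andP[? ?] /andP[? ?] /andP[? ?] /andP[? ?].
rewrite -[X in X - _]/(\int[nu]_x g x) -[X in _ - X]/(\int[lift_prob mu]_x g x).
by apply/andP; split; lra.
Unshelve. all: by end_near. Qed.

End limit_measure.

(** Helly selection for ultrafilters: along an ultrafilter the distribution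
functions converge at every point. *)
Lemma circle_prob_compact : compact [set: circle_prob R].
Proof.
rewrite compact_ultra => F FU _.
have FH (y : R) : exists l : R, cdf_real (lift_prob mu) y @[mu --> F] --> l.
  have [l _ Fl] := @ultra_bounded_cvg R _ F (fun mu => cdf_real (lift_prob mu) y)
    0 1 FU (fun mu => introT andP (conj (cdf_real_ge0 _ _) (cdf_real_le1 _ _))).
  by exists l.
have [H {}FH] := choice FH.
by have [mu0 Fmu0] := cvg_limit_measure FU FH; exists mu0.
Qed.

End weak_compactness.

(** * Baire category in compact regular spaces *)

(** Closed neighbourhoods pull back along [f]. *)
Lemma initial_regular (S : choiceType) (T : topologicalType) (f : S -> T) :
  regular_space T -> regular_space (initial_topology f).
Proof.
move=> rT x V [_ [[B oB <-] Bx BV]].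
have [C Cx CB] := rT (f x) B (open_nbhs_nbhs (conj oB Bx)).
exists (f @^-1` C) => [|y].
  exact: (@initial_continuous _ _ f x).
move=> cy; apply: BV; apply: CB => W Wy.
have [|z [/= Cz Wz]] := cy (f @^-1` W).
  exact: (@initial_continuous _ _ f y).
by exists (f z).
Qed.

(** Nested open sets whose closures decrease have a common point by
compactness.  Regularity is the right separation property for measures:
two of them that agree on the Borel sets cannot be separated, although they may
differ elsewhere. *)
Lemma compact_regular_baire (T : topologicalType) (O : nat -> set T) :
  compact [set: T] -> regular_space T ->
  (forall n, open (O n) /\ dense (O n)) -> dense (\bigcap_n O n).
Proof.
move=> cT rT odO U [u Uu] oU.
have shrink (V : set T) (n : nat) : exists W : set T, open V -> V !=set0 ->
    [/\ open W, W !=set0, closure W `<=` V & W `<=` O n].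
  have [oV|] := pselect (open V); last by exists setT.
  have [V0|] := pselect (V !=set0); last by exists setT.
  have [oO dO] := odO n.
  have [x [Vx Ox]] := dO V V0 oV.
  have [C Cx CV] := rT x (V `&` O n) (open_nbhs_nbhs (conj (openI oV oO) (conj Vx Ox))).
  exists C°%classic => _ _; split.
  - exact: open_interior.
  - by exists x.
  - by move=> y /(closureS (@interior_subset _ C)) /CV [].
  - by move=> y /interior_subset /subset_closure /CV [].
pose next V n := sval (cid (shrink V n)).
pose W := fix W n := if n is k.+1 then next (W k) k else U.
have WP n : open (W n) /\ W n !=set0.
  elim: n => [|n [oW W0]]; first by split; [|exists u].
  by have [] := svalP (cid (shrink (W n) n)) oW W0.
have WS n : closure (W n.+1) `<=` W n.
  by have [oW W0] := WP n; have [] := svalP (cid (shrink (W n) n)) oW W0.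
have WO n : W n.+1 `<=` O n.
  by have [oW W0] := WP n; have [] := svalP (cid (shrink (W n) n)) oW W0.
have Wmono m n : (m <= n)%N -> W n `<=` W m.
  move=> /subnK <-; elim: (n - m)%N => // k IHk x Wx.
  by apply: IHk; apply: (WS _ x); exact: subset_closure.
pose F := filter_from [set: nat] W.
have PF : ProperFilter F.
  apply: filter_from_proper; last by move=> n _; case: (WP n).
  apply: filter_from_filter; first by exists 0%N.
  move=> i j _ _; exists (maxn i j) => // x Wx.
  by split; apply: Wmono Wx; rewrite ?leq_maxl ?leq_maxr.
have [x [_ clx]] := cT F PF (@filterT _ F _).
have Wx n : W n x.
  by apply: (WS n); move=> B Bx; apply: clx => //; exists n.+1.
exists x; split; first exact: (Wx 0%N).
by move=> n _; exact: (WO n x (Wx n.+1)).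
Qed.

Lemma compact_set_type (T : topologicalType) (A : set T) :
  compact A -> compact [set: A].
Proof.
move=> cA F FF _.
have [|a [Aa cla]] := cA (set_val @ F) (fmap_proper_filter _ FF).
  by apply: (@filterS _ F _ setT _ _ filterT) => x _ /=; exact: set_valP.
exists (SigSub (mem_set Aa)); split=> // B C FB [_ [[D oD <-] Da DC]].
have [|_ [[x Bx <-] Dx]] := cla (set_val @` B) D _ (open_nbhs_nbhs (conj oD Da)).
  by apply: (@filterS _ F _ B _ _ FB) => x Bx; exists x.
by exists x; split=> //; exact: DC.
Qed.

(** * Determination of a probability measure by its integrals *)

Section separation.
Variable R : realType.
Implicit Types mu nu : circle_prob R.

Definition set_distance (A : set R) (x : R) := inf [set `|x - s| | s in A].

Lemma set_distance_lip (A : set R) (x y : R) :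
  A !=set0 -> `|set_distance A x - set_distance A y| <= `|x - y|.
Proof.
move=> [a Aa].
have hi z : has_inf [set `|z - s| | s in A].
  by split; [exists `|z - a|, a | exists 0 => _ [s _ <-]].
have half z w : set_distance A z - set_distance A w <= `|z - w|.
  rewrite lerBlDr -lerBlDl; apply: lb_le_inf; first by case: (hi w).
  move=> _ [s As <-]; rewrite lerBlDl.
  apply: (@le_trans _ _ `|z - s|).
    by apply: ge_inf; [case: (hi z)|exists s].
  by rewrite -(subrKA w) ler_normD.
by rewrite ler_norml half andbT lerNl opprB distrC half.
Qed.

Lemma set_distance_shift (A : set R) x (k : R) :
  (forall s, A s <-> A (s + k)) -> set_distance A (x + k) = set_distance A x.
Proof.
move=> Ak; congr inf; apply/seteqP; split => _ [s As <-] /=.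
  by exists (s - k); [rewrite Ak subrK|congr `|_|; ring].
by exists (s + k); [rewrite -Ak|congr `|_|; ring].
Qed.

(** The continuous functions min(1, n d), where d is the distance to the
complement of [U], increase to the indicator function of [U].  The distance is
taken on the line, to the full inverse image of the complement; this set is
1-periodic, so that the distance descends to the circle. *)
Lemma le_circle_prob_open mu nu (U : set (circle R)) :
  (forall f : circle R -> R, continuous f -> \int[mu]_x f x = \int[nu]_x f x) ->
  open U -> (mu U <= nu U)%E.
Proof.
move=> fE oU; have mU : measurable U by exact: sub_sigma_algebra.
pose A : set R := [set s | ~ U (circle_proj s)].
have [[a Aa]|A0] := pselect (A !=set0); last first.
  have -> : U = setT.
    apply/seteqP; split=> // c _; apply: contrapT => nUc; apply: A0.
    by exists (circle_lift c); rewrite /A/= circle_liftK.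
  by rewrite !(@probability_setT _ _ _ _).
have An : A !=set0 by exists a.
pose d c := set_distance A (circle_lift c).
have dproj x : d (circle_proj x) = set_distance A x.
  rewrite /d circle_lift_projE; apply: set_distance_shift => s; rewrite /A/=.
  suff -> : circle_proj (s - (Num.floor x)%:~R) = circle_proj s by [].
  by apply/circle_proj_eq; rewrite addrAC subrr add0r rpredN intr_int.
have d_lb c : lbound [set `|circle_lift c - s| | s in A] 0 by move=> _ [s _ <-].
have d_ge0 c : 0 <= d c by apply: lb_le_inf => //; exists `|circle_lift c - a|, a.
have d_out c : ~ U c -> d c = 0.
  move=> nUc; apply/eqP; rewrite eq_le d_ge0 andbT.
  apply: ge_inf; first by exists 0; exact: d_lb.
  by exists (circle_lift c); rewrite ?subrr ?normr0// /A/= circle_liftK.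
have d_in c : U c -> 0 < d c.
  rewrite -{1}(circle_liftK c) => Uc.
  have : nbhs (circle_lift c) (@circle_proj R @^-1` U).
    by apply: open_nbhs_nbhs; split; [exact: oU|].
  move=> /nbhs_ballP[r /= r0 rU]; apply: (lt_le_trans r0).
  apply: lb_le_inf; first by exists `|circle_lift c - a|, a.
  move=> _ [s As <-]; rewrite leNgt; apply/negP => cs.
  by apply: As; exact: rU.
pose f n c := Num.min 1 (n%:R * d c).
have cf n : continuous (f n).
  apply: circle_continuous; rewrite /comp /f.
  under eq_fun do rewrite dproj.
  move=> x; apply: (@continuous_min R _ (fun=> 1) (fun y => n%:R * set_distance A y)).
    exact: cvg_cst.
  apply: cvgMr => //; apply/cvgrPdist_le => e e0.
  exists e => // y /= xy; apply: le_trans (set_distance_lip _ _ An) _.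
  exact: ltW.
have bf n := continuous_circle_bounded_mfun (cf n).
pose K n : set (circle R) := [set c | 1 <= n%:R * d c].
have mK n : measurable (K n).
  rewrite (_ : K n = f n @^-1` [set` `[1, +oo[]).
    by rewrite -[X in measurable X]setTI; case: (bf n) => mf _; exact: mf.
  by apply/seteqP; split => c; rewrite /K/= in_itv/= andbT /f le_min lexx.
have UK : U = \bigcup_n K n.
  apply/seteqP; split => [c Uc|c [n _ Kc]].
    exists (Num.truncn (d c)^-1).+1 => //; rewrite /K/=.
    by rewrite -ler_pdivrMr ?d_in// div1r ltW// truncnS_gt.
  apply: contrapT => /d_out dc; move: Kc.
  by rewrite /K/= dc mulr0 leNgt ltr01.
have Kmono : nondecreasing_seq K.
  move=> i j ij; apply/subsetPset => c; rewrite /K/= => /le_trans; apply.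
  by rewrite ler_wpM2r// ler_nat.
have KU n : (mu (K n) <= nu U)%E.
  have fin (m : circle_prob R) B : measurable B -> m B \is a fin_num.
    by move=> mB; rewrite fin_num_measure.
  rewrite -(fineK (fin mu _ (mK n))) -(fineK (fin nu _ mU)) lee_fin.
  have measE (m : circle_prob R) B : measurable B ->
      fine (m B) = \int[m]_x \1_B x.
    move=> mB; rewrite /Rintegral integral_indic// setIT.
    by [].
  have bi B : measurable B -> bounded_mfun (\1_B : circle R -> R).
    move=> mB; split; first exact: measurable_indic.
    by exists 1 => c; rewrite indicE ger0_norm// lern1 leq_b1.
  rewrite !measE//; apply: (@le_trans _ _ (\int[mu]_x f n x)).
    apply: le_mean => //; first exact: bi.
    move=> c; rewrite indicE /f le_min; case: (boolP (c \in K n)) => [|_].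
      by rewrite inE /K/= lexx => ->.
    by rewrite ler01 mulr_ge0.
  rewrite fE//; apply: le_mean => //; first exact: bi.
  move=> c; rewrite indicE; case: (boolP (c \in U)) => [_|].
    by rewrite ge_min lexx.
  by rewrite notin_setE => /d_out dc; rewrite /f dc mulr0 ge_min lexx orbT.
have mKU : measurable (\bigcup_n K n) by rewrite -UK.
have := nondecreasing_cvg_mu (mu := mu) mK mKU Kmono.
rewrite -UK => muK; apply: (cvge_to_le muK).
by apply: nearW => n; exact: KU.
Qed.

(** The open sets are stable under intersection and generate the Borel sets. *)
Lemma circle_prob_unique mu nu :
  (forall f : circle R -> R, continuous f -> \int[mu]_x f x = \int[nu]_x f x) ->
  forall A, measurable A -> mu A = nu A.
Proof.
move=> fE A mA.
apply: (measure_unique (@open (circle R)) (fun=> setT)) => //.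
- exact: openI.
- by move=> _; exact: openT.
- by rewrite bigcup_const.
- by move=> U oU; apply/eqP; rewrite eq_le !le_circle_prob_open// => f cf; rewrite fE.
- by move=> _; rewrite -ge0_fin_numE ?fin_num_measure.
Qed.

End separation.

(** * The space of invariant measures *)

Section invariant.
Variable R : realType.
Implicit Types (mu nu : circle_prob R) (f : circle R -> R).

Lemma mean_push n mu f : continuous f ->
  \int[circle_push n mu]_x f x = \int[mu]_x f (circle_times n x).
Proof.
by move=> cf; rewrite mean_distribution//; exact: continuous_circle_bounded_mfun.
Qed.

Lemma continuous_comp_times n f : continuous f ->
  continuous (fun x => f (circle_times n x)).
Proof.
move=> cf x; apply: (@continuous_comp _ _ _ (@circle_times R n) f); last exact: cf.
exact: circle_times_continuous.
Qed.

Lemma continuous_mean f : continuous f ->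
  continuous (fun mu : circle_prob R => \int[mu]_x f x).
Proof.
move=> cf mu; have /cvg_circle_prob := @cvg_id _ (nbhs mu).
by move=> /(_ (mkcts cf)).
Qed.

(** In this form invariance is visibly a closed condition. *)
Lemma invariant_probP p mu : invariant_prob R p mu <->
  forall f, continuous f -> \int[mu]_x f (circle_times p x) = \int[mu]_x f x.
Proof.
split=> [inv f cf|inv].
  rewrite -mean_push//; congr fine.
  by apply: eq_measure_integral => A mA _; exact: inv.
move=> A mA; apply: circle_prob_unique => // f cf.
by rewrite mean_push// inv.
Qed.

Lemma closed_invariant_prob p : closed (invariant_prob R p).
Proof.
move=> mu clmu; apply/invariant_probP => f cf; apply/eqP; rewrite -subr_eq0.
pose g (nu : circle_prob R) := \int[nu]_x f (circle_times p x) - \int[nu]_x f x.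
have cg : continuous g.
  move=> nu; apply: cvgB; last exact: (continuous_mean cf).
    exact: nbhs_filter.
  exact: (continuous_mean (@continuous_comp_times p f cf)).
have : closed (g @^-1` [set 0]).
  by apply: closed_comp => [nu _|]; [exact: cg|exact: closed_eq].
suff inv0 : invariant_prob R p `<=` g @^-1` [set 0].
  by move=> /(_ mu) g0; apply/eqP; apply: g0; exact: closureS clmu.
by move=> nu /invariant_probP inv; rewrite /g/= inv// subrr.
Qed.

Lemma compact_invariant_prob p : compact [set: invariant_prob R p].
Proof.
apply: compact_set_type.
apply: (subclosed_compact _ (@circle_prob_compact R)) => //.
exact: closed_invariant_prob.
Qed.

Lemma regular_invariant_prob p : regular_space (invariant_prob R p).
Proof.
apply: initial_regular; apply: (@initial_regular _ _ (@integrals R)).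
exact: uniform_regular.
Qed.

Lemma baire_invariant_prob p (O : nat -> set (invariant_prob R p)) :
  (forall n, open (O n) /\ dense (O n)) -> dense (\bigcap_n O n).
Proof.
apply: compact_regular_baire; first exact: compact_invariant_prob.
exact: regular_invariant_prob.
Qed.

End invariant.

(** * Exponentials *)

Section cis.
Variable R : realType.
Local Notation C := R[i].
Local Notation normc := (@ComplexField.Normc.normc R).
Implicit Types x y : R.

Definition cis x : C := Complex (cos (2 * pi * x)) (sin (2 * pi * x)).

Lemma cisD x y : cis (x + y) = cis x * cis y.
Proof. by rewrite /cis mulrDr cosD sinD; apply/eqP; rewrite eq_complex /= eqxx/= addrC. Qed.

Lemma cis0 : cis 0 = 1.
Proof. by rewrite /cis mulr0 cos0 sin0. Qed.

Lemma cis1 : cis 1 = 1.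
Proof. by rewrite /cis mulr1 mulr_natl cos2pi sin2pi. Qed.

Lemma cisMn x n : cis (n%:R * x) = cis x ^+ n.
Proof.
elim: n => [|n IHn]; first by rewrite mul0r cis0.
by rewrite -natr1 mulrDl mul1r cisD IHn exprSr.
Qed.

Lemma cis_nat n : cis n%:R = 1.
Proof. by rewrite -[n%:R]mulr1 cisMn cis1 expr1n. Qed.

Lemma cis_int x : x \is a Num.int -> cis x = 1.
Proof.
move=> /intrP[[n|n] ->]; first exact: cis_nat.
have := cisD (Negz n)%:~R n.+1%:R.
by rewrite cis_nat mulr1 NegzE rmorphN/= addNr cis0.
Qed.

Lemma normc_ge0 (z : C) : 0 <= normc z.
Proof. by case: z => x y; exact: sqrtr_ge0. Qed.

Lemma normc_cis x : normc (cis x) = 1.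
Proof. by rewrite /cis/= cos2Dsin2 sqrtr1. Qed.

Lemma cis_shift x y : x - y \is a Num.int -> cis x = cis y.
Proof. by move=> /cis_int xy; rewrite -(subrK y x) cisD xy mul1r. Qed.

Lemma cos_shift x y : x - y \is a Num.int -> cos (2 * pi * x) = cos (2 * pi * y).
Proof. by move=> /cis_shift []. Qed.

Lemma sin_shift x y : x - y \is a Num.int -> sin (2 * pi * x) = sin (2 * pi * y).
Proof. by move=> /cis_shift []. Qed.

Lemma le_Re_normc (z : C) : `|complex.Re z| <= normc z.
Proof.
case: z => a b /=; rewrite -sqrtr_sqr ler_wsqrtr//.
by rewrite lerDl sqr_ge0.
Qed.

Lemma le_Im_normc (z : C) : `|complex.Im z| <= normc z.
Proof.
case: z => a b /=; rewrite -sqrtr_sqr ler_wsqrtr//.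
by rewrite lerDr sqr_ge0.
Qed.

Lemma normc_sum (I : Type) (r : seq I) (F : I -> C) :
  normc (\sum_(i <- r) F i) <= \sum_(i <- r) normc (F i).
Proof.
elim: r => [|i r IHr]; first by rewrite !big_nil ComplexField.Normc.normc0.
by rewrite !big_cons (le_trans (le_normcD _ _))// lerD2l.
Qed.

Lemma normc_prod (I : Type) (r : seq I) (F : I -> C) :
  normc (\prod_(i <- r) F i) = \prod_(i <- r) normc (F i).
Proof.
elim: r => [|i r IHr]; first by rewrite !big_nil ComplexField.Normc.normc1.
by rewrite !big_cons ComplexField.Normc.normcM IHr.
Qed.

Lemma Re_sum (I : Type) (r : seq I) (F : I -> C) :
  complex.Re (\sum_(i <- r) F i) = \sum_(i <- r) complex.Re (F i).
Proof.
elim: r => [|i r IHr]; first by rewrite !big_nil.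
by rewrite !big_cons -IHr; case: (F i) (\sum_(j <- r) F j) => a b [].
Qed.

Lemma Im_sum (I : Type) (r : seq I) (F : I -> C) :
  complex.Im (\sum_(i <- r) F i) = \sum_(i <- r) complex.Im (F i).
Proof.
elim: r => [|i r IHr]; first by rewrite !big_nil.
by rewrite !big_cons -IHr; case: (F i) (\sum_(j <- r) F j) => a b [].
Qed.

(** The modulus of a geometric sum is at most 2 / |1 - cis x|; multiplied
out, the bound also makes sense when [cis x = 1]. *)
Lemma cis_geometric x m : normc (\sum_(l < m) cis (l%:R * x)) * normc (1 - cis x) <= 2.
Proof.
under eq_bigr do rewrite cisMn.
have := subrX1 (cis x) m; rewrite mulrC.
have -> : 1 - cis x = - (cis x - 1) by rewrite opprB.
rewrite normcN -ComplexField.Normc.normcM => <-.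
rewrite (le_trans (le_normcD _ _))// normcN ComplexField.Normc.normc1.
by rewrite -cisMn normc_cis.
Qed.

Lemma segment_pi y : 0 <= y <= 2^-1 -> 2 * pi * y \in `[0, pi].
Proof.
move=> /andP[y0 y2]; have pi0 := pi_gt0 R; rewrite in_itv/=; apply/andP; split.
  by rewrite !mulr_ge0// ltW.
have : pi * (2 * y) <= pi * 1 by rewrite ler_pM2l//; lra.
by rewrite mulr1 mulrCA mulrA.
Qed.

(** Modulo 1 and up to sign, [x] lies in [d, 1/2], where the cosine of
2 pi x decreases. *)
Lemma cos_far x d : 0 < d -> d <= 2^-1 -> (forall k : int, d <= `|x - k%:~R|) ->
  cos (2 * pi * x) <= cos (2 * pi * d).
Proof.
move=> d0 d2 xk; have pi0 := pi_gt0 R.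
have cosle y : d <= y <= 2^-1 -> cos (2 * pi * y) <= cos (2 * pi * d).
  move=> /andP[dy y2]; rewrite leNgt; apply/negP.
  rewrite ltr_cos ?segment_pi ?(ltW d0) ?(le_trans (ltW d0) dy)//.
  by rewrite ltr_pM2l ?mulr_gt0// ltNge dy.
set n := Num.floor x; set y := x - n%:~R.
have -> : cos (2 * pi * x) = cos (2 * pi * y).
  by apply: cos_shift; rewrite /y opprB addrC subrK intr_int.
have y0 : 0 <= y by rewrite subr_ge0 floor_le_tmp.
have y1 : y < 1 by have := floorD1_gt x; rewrite /y ltrBlDl intrD.
have dy : d <= y by have := xk n; rewrite -/y ger0_norm.
have dy1 : d <= 1 - y.
  have := xk (n + 1); rewrite intrD (_ : x - _ = - (1 - y)) ?normrN.
    by rewrite ger0_norm// subr_ge0 ltW.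
  by rewrite /y; ring.
have [y2|y2] := leP y 2^-1; first by rewrite cosle// dy.
have -> : cos (2 * pi * y) = cos (2 * pi * (1 - y)).
  rewrite -[LHS]cosN -mulrN; apply: cos_shift.
  have -> : - y - (1 - y) = - 1 by ring.
  by rewrite rpredN rpred1.
by rewrite cosle// dy1/=; lra.
Qed.

Lemma far_gap_gt0 (d : R) : 0 < d -> d <= 2^-1 -> 0 < 1 - cos (2 * pi * d).
Proof.
move=> d0 d2; have pi0 := pi_gt0 R; rewrite subr_gt0.
rewrite [ltRHS](_ : _ = cos (2 * pi * 0)); last by rewrite mulr0 cos0.
rewrite ltr_cos ?ltr_pM2l ?mulr_gt0//; apply: segment_pi.
  by rewrite lexx invr_ge0 ler0n.
by rewrite ltW.
Qed.

Lemma cis_far x d : 0 < d -> d <= 2^-1 -> (forall k : int, d <= `|x - k%:~R|) ->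
  1 - cos (2 * pi * d) <= normc (1 - cis x).
Proof.
move=> d0 d2 xk; apply: le_trans (le_Re_normc _).
apply: le_trans (ler_norm _) => /=.
by rewrite lerD2l lerN2 cos_far.
Qed.

(** The distance from [x] to the nearest integer is a suitable [d]. *)
Lemma far_int x : x \isn't a Num.int ->
  exists2 d, 0 < d & d <= 2^-1 /\ forall k : int, d <= `|x - k%:~R|.
Proof.
move=> nx; set y := x - (Num.floor x)%:~R.
have y0 : 0 < y.
  rewrite subr_gt0 lt_neqAle floor_le_tmp andbT.
  by apply: contraNneq nx => <-; exact: intr_int.
have y1 : y < 1 by have := floorD1_gt x; rewrite /y ltrBlDl intrD.
exists (Num.min 2^-1 (Num.min y (1 - y))).
  by rewrite !lt_min y0 subr_gt0 y1 invr_gt0 ltr0n.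
split=> [|k]; first by rewrite ge_min lexx.
have [kx|kx] := leP k (Num.floor x).
  rewrite !ge_min; apply/orP; right; apply/orP; left.
  rewrite -/y (le_trans _ (ler_norm _))// lerD2l lerN2 ler_int//.
rewrite !ge_min; apply/orP; right; apply/orP; right.
rewrite distrC (le_trans _ (ler_norm _))// /y opprB addrA lerD2r.
by move: kx; rewrite -lezD1 -(ler_int R) intrD addrC.
Qed.

Lemma cis_eq1 x : cis x = 1 -> x \is a Num.int.
Proof.
move=> cx; apply/negPn/negP => /far_int[d d0 [d2 xd]].
have := cis_far d0 d2 xd; rewrite cx subrr ComplexField.Normc.normc0.
by rewrite leNgt far_gap_gt0.
Qed.

End cis.

(** * The Fejer kernel *)

Section fejer.
Variable R : realType.
Local Notation normc := (@ComplexField.Normc.normc R).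
Implicit Types x y t : R.

(** The Fejer kernel, normalised so that its value at the integers is 1.
Written as a square it is visibly nonnegative; [fejerE] shows it as a
trigonometric polynomial. *)
Definition fejer m x : R := (normc (\sum_(l < m) cis (l%:R * x)) / m%:R) ^+ 2.

Lemma fejer_ge0 m x : 0 <= fejer m x.
Proof. exact: sqr_ge0. Qed.

Lemma sqr_normc (z : R[i]) : normc z ^+ 2 = complex.Re z ^+ 2 + complex.Im z ^+ 2.
Proof. by case: z => a b /=; rewrite sqr_sqrtr// addr_ge0// sqr_ge0. Qed.

Lemma fejerE m x : fejer m x = m%:R ^- 2 *
  \sum_(l < m) \sum_(k < m) cos (2 * pi * (`|l - k|%N%:R * x)).
Proof.
rewrite /fejer expr_div_n sqr_normc mulrC; congr (_ * _).
rewrite Re_sum Im_sum /= !expr2 !big_distrlr/= -big_split/=.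
apply: eq_bigr => l _; rewrite -big_split/=; apply: eq_bigr => k _.
rewrite -cosB -mulrBr -mulrBl.
have [kl|lk] := leqP k l.
  by rewrite distnEl// natrB.
by rewrite distnEr ?natrB 1?ltnW// -(opprB k%:R) mulNr mulrN cosN.
Qed.

Lemma fejer_far m x d : (0 < m)%N -> 0 < d -> d <= 2^-1 ->
  (forall k : int, d <= `|x - k%:~R|) ->
  fejer m x <= (2 / (m%:R * (1 - cos (2 * pi * d)))) ^+ 2.
Proof.
move=> m0 d0 d2 xk; have K0 := far_gap_gt0 d0 d2.
have nc := @normc_ge0 R.
have m0' : 0 < m%:R :> R by rewrite ltr0n.
rewrite /fejer ler_sqr ?nnegrE ?divr_ge0// ?mulr_ge0 ?(ltW K0)//.
rewrite [leRHS](_ : _ = 2 / (1 - cos (2 * pi * d)) / m%:R); last first.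
  by rewrite invfM mulrA mulrAC.
rewrite ler_pM2r ?invr_gt0//.
rewrite ler_pdivlMr//; apply: le_trans (cis_geometric x m).
by rewrite ler_wpM2l// cis_far.
Qed.

(** For such [x] all the angles 2 pi l x are at most pi / 4 in absolute
value, so every term of the sum has real part at least 1/2. *)
Lemma fejer_near m x : (0 < m)%N -> `|x| <= (8 * m%:R)^-1 -> 4^-1 <= fejer m x.
Proof.
move=> m0 xm; have m0' : 0 < m%:R :> R by rewrite ltr0n.
have nc := @normc_ge0 R.
have -> : 4^-1 = 2^-1 ^+ 2 :> R by rewrite expr2 -invfM -natrM.
rewrite /fejer ler_sqr ?nnegrE ?divr_ge0 ?invr_ge0//.
rewrite ler_pdivlMr// (le_trans _ (le_Re_normc _))//.
rewrite (le_trans _ (ler_norm _))// Re_sum/=.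
have -> : 2^-1 * m%:R = \sum_(l < m) 2^-1 :> R by rewrite sumr_const card_ord mulr_natr.
apply: ler_sum => l _; rewrite -[leRHS]cos_norm.
have -> : `|2 * pi * (l%:R * x)| = 2 * pi * (l%:R * `|x|).
  by rewrite !normrM (ger0_norm (pi_ge0 R)) !normr_nat.
have lx : l%:R * `|x| <= 8^-1.
  rewrite (@le_trans _ _ (m%:R * (8 * m%:R)^-1))//.
    by apply: ler_pM => //; rewrite ler_nat (ltnW (ltn_ord l)).
  by rewrite invfM mulrCA mulfV ?mulr1 ?gt_eqF.
have c8 : 2^-1 <= cos (2 * pi * 8^-1) :> R.
  have pi8 : 2 * pi * 8^-1 = pi / 4 :> R by field.
  have c0 : 0 <= cos (pi / 4) :> R.
    by apply: cos_ge0_pihalf; have := pi_gt0 R; lra.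
  have := cos_mulr2n (pi / 4 : R); rewrite (_ : pi / 4 *+ 2 = pi / 2); last first.
    by rewrite -mulr_natr; field.
  rewrite cos_pihalf pi8 => /esym/eqP; rewrite subr_eq0 => /eqP c2.
  have c1 := cos_le1 (pi / 4 : R).
  by rewrite expr2 in c2; nra.
apply: (le_trans c8); rewrite leNgt; apply/negP.
rewrite ltr_cos ?segment_pi//; first by rewrite ltr_pM2l ?mulr_gt0 ?pi_gt0// ltNge lx.
  by lra.
by rewrite mulr_ge0//=; lra.
Qed.

(** This is a phase times the sum of the powers of a nontrivial m-th root of
unity. *)
Lemma cos_sum_translates m d x : (0 < d < m)%N ->
  \sum_(j < m) cos (2 * pi * (d%:R * (x - j%:R / m%:R))) = 0.
Proof.
move=> /andP[d0 dm]; have m0 : (0 < m)%N by exact: leq_trans dm.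
have m0' : 0 < m%:R :> R by rewrite ltr0n.
have d0' : 0 < d%:R :> R by rewrite ltr0n.
set u : R := - (d%:R / m%:R).
have cu : cis u != 1.
  apply/negP => /eqP/cis_eq1; rewrite rpredN => /intrP[k uk].
  have : 0 < (k%:~R : R) by rewrite -uk divr_gt0.
  have : (k%:~R : R) < 1 by rewrite -uk ltr_pdivrMr// mul1r ltr_nat.
  by rewrite (ltrz1 R) ltr0z; lia.
have -> : \sum_(j < m) cos (2 * pi * (d%:R * (x - j%:R / m%:R))) =
    complex.Re (cis (d%:R * x) * \sum_(j < m) cis (j%:R * u)).
  rewrite mulr_sumr Re_sum; apply: eq_bigr => j _.
  rewrite -cisD /=; congr (cos (_ * _)); rewrite /u; field.
  by rewrite gt_eqF.
have -> : \sum_(j < m) cis (j%:R * u) = 0.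
  under eq_bigr do rewrite cisMn.
  apply: (mulfI (x := cis u - 1)); first by rewrite subr_eq0.
  rewrite -subrX1 mulr0 -cisMn cis_int ?subrr// /u mulrN rpredN.
  by rewrite mulrCA mulfV ?gt_eqF// mulr1 rpred_nat.
by rewrite mulr0.
Qed.

(** All frequencies of the kernel are below [m], so that the sum over the
translates by multiples of 1/m keeps the constant term only.  The translates
thus form a partition of unity. *)
Lemma fejer_sum_translates m x : (0 < m)%N ->
  \sum_(j < m) fejer m (x - j%:R / m%:R) = 1.
Proof.
move=> m0; have m0' : m%:R != 0 :> R by rewrite pnatr_eq0 -lt0n.
under eq_bigr do rewrite fejerE; rewrite -mulr_sumr exchange_big/=.
rewrite (_ : \sum_(l < m) _ = m%:R ^+ 2) ?mulVf ?expf_neq0//.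
have -> : m%:R ^+ 2 = \sum_(l < m) m%:R :> R.
  by rewrite sumr_const card_ord expr2 mulr_natr.
apply: eq_bigr => l _; rewrite exchange_big/= (bigD1 l)//= [X in _ + X]big1.
  rewrite distnn addr0; under eq_bigr do rewrite mul0r mulr0 cos0.
  by rewrite sumr_const card_ord.
move=> k kl; apply: cos_sum_translates.
rewrite lt0n distn_eq0 eq_sym kl/=.
by have := ltn_ord k; have := ltn_ord l; lia.
Qed.

End fejer.

(** * Fourier coefficients of probability measures *)

Section fourier.
Variable R : realType.
Implicit Types (mu nu : circle_prob R) (f : circle R -> R) (c : circle R).

Definition circle_cos (a : nat) c : R := cos (2 * pi * (a%:R * circle_lift c)).
Definition circle_sin (a : nat) c : R := sin (2 * pi * (a%:R * circle_lift c)).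

Lemma nat_lift_int (a : nat) (x : R) :
  a%:R * circle_lift (circle_proj x) - a%:R * x \is a Num.int.
Proof.
rewrite -mulrBr rpredM ?rpred_nat// circle_lift_projE addrAC subrr add0r.
by rewrite rpredN intr_int.
Qed.

Lemma circle_cos_proj a x : circle_cos a (circle_proj x) = cos (2 * pi * (a%:R * x)).
Proof. by apply: cos_shift; exact: nat_lift_int. Qed.

Lemma circle_sin_proj a x : circle_sin a (circle_proj x) = sin (2 * pi * (a%:R * x)).
Proof. by apply: sin_shift; exact: nat_lift_int. Qed.

Lemma continuous_circle_cos a : continuous (circle_cos a).
Proof.
apply: circle_continuous; rewrite /comp; under eq_fun do rewrite circle_cos_proj.
move=> x; apply: continuous_comp; last exact: continuous_cos.
by apply: cvgMr; apply: cvgMr; exact: cvg_id.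
Qed.

Lemma continuous_circle_sin a : continuous (circle_sin a).
Proof.
apply: circle_continuous; rewrite /comp; under eq_fun do rewrite circle_sin_proj.
move=> x; apply: continuous_comp; last exact: continuous_sin.
by apply: cvgMr; apply: cvgMr; exact: cvg_id.
Qed.

Lemma bounded_circle_cos a : bounded_mfun (circle_cos a).
Proof. exact/continuous_circle_bounded_mfun/continuous_circle_cos. Qed.

Lemma bounded_circle_sin a : bounded_mfun (circle_sin a).
Proof. exact/continuous_circle_bounded_mfun/continuous_circle_sin. Qed.

Definition fourier_cos a mu : R := \int[mu]_c circle_cos a c.
Definition fourier_sin a mu : R := \int[mu]_c circle_sin a c.

Lemma circle_cos_times a n c : circle_cos a (circle_times n c) = circle_cos (a * n) c.
Proof.
rewrite -(circle_liftK c) circle_times_proj !circle_cos_proj.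
by rewrite -mulr_natr natrM; congr (cos (_ * _)); ring.
Qed.

Lemma circle_sin_times a n c : circle_sin a (circle_times n c) = circle_sin (a * n) c.
Proof.
rewrite -(circle_liftK c) circle_times_proj !circle_sin_proj.
by rewrite -mulr_natr natrM; congr (sin (_ * _)); ring.
Qed.

Lemma fourier_cos_push a n mu : fourier_cos a (circle_push n mu) = fourier_cos (a * n) mu.
Proof.
rewrite /fourier_cos mean_push; last exact: continuous_circle_cos.
by apply: eq_Rintegral => c _; rewrite circle_cos_times.
Qed.

Lemma fourier_sin_push a n mu : fourier_sin a (circle_push n mu) = fourier_sin (a * n) mu.
Proof.
rewrite /fourier_sin mean_push; last exact: continuous_circle_sin.
by apply: eq_Rintegral => c _; rewrite circle_sin_times.
Qed.

Lemma fejer_lift m c t : fejer m (circle_lift c - t) = m%:R ^- 2 *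
  \sum_(l < m) \sum_(k < m)
    (cos (2 * pi * (`|l - k|%N%:R * t)) * circle_cos `|l - k|%N c +
     sin (2 * pi * (`|l - k|%N%:R * t)) * circle_sin `|l - k|%N c).
Proof.
rewrite fejerE; congr (_ * _); apply: eq_bigr => l _; apply: eq_bigr => k _.
rewrite [X in 2 * pi * X]mulrBr [X in cos X]mulrBr cosB.
by rewrite mulrC [X in _ + X]mulrC.
Qed.

Lemma bounded_fejer_term a b1 b2 :
  bounded_mfun (fun c => b1 * circle_cos a c + b2 * circle_sin a c).
Proof.
apply: bounded_mfunD; apply: bounded_mfunZ; first exact: bounded_circle_cos.
exact: bounded_circle_sin.
Qed.

Lemma bounded_fejer m t : bounded_mfun (fun c => fejer m (circle_lift c - t)).
Proof.
under eq_fun do rewrite fejer_lift.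
apply: bounded_mfunZ; apply: bounded_mfun_sum => l; apply: bounded_mfun_sum => k.
exact: bounded_fejer_term.
Qed.

Lemma circle_cos0 c : circle_cos 0 c = 1.
Proof. by rewrite /circle_cos mul0r mulr0 cos0. Qed.

Lemma circle_sin0 c : circle_sin 0 c = 0.
Proof. by rewrite /circle_sin mul0r mulr0 sin0. Qed.

(** The constant term of the kernel is 1/m, and each of the other ones
contributes a coefficient of [mu] of frequency below [m]. *)
Lemma mean_fejer mu m t e : (0 < m)%N -> 0 <= e ->
  (forall a, (0 < a < m)%N -> `|fourier_cos a mu| <= e /\ `|fourier_sin a mu| <= e) ->
  `|\int[mu]_c fejer m (circle_lift c - t) - m%:R^-1| <= 2 * e.
Proof.
move=> m0 e0 small; have m0' : 0 < m%:R :> R by rewrite ltr0n.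
under eq_Rintegral do rewrite fejer_lift.
rewrite meanZ; last first.
  by do 2 apply: bounded_mfun_sum => ?; exact: bounded_fejer_term.
rewrite mean_sum; last by move=> l; apply: bounded_mfun_sum => ?; exact: bounded_fejer_term.
have -> : m%:R^-1 = m%:R ^- 2 * \sum_(l < m) \sum_(k < m) (l == k)%:R :> R.
  under eq_bigr => l _.
    rewrite (bigD1 l)//= big1 ?addr0 ?eqxx; last by move=> k; rewrite eq_sym => /negPf ->.
    over.
  by rewrite sumr_const card_ord expr2 invfM -mulrA mulVf ?mulr1 ?gt_eqF.
rewrite -mulrBr normrM ger0_norm ?invr_ge0 ?exprn_ge0//.
rewrite ler_pdivrMl ?exprn_gt0//.
have -> : m%:R ^+ 2 * (2 * e) = \sum_(l < m) \sum_(k < m) (2 * e).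
  by rewrite !sumr_const !card_ord -[in RHS]mulrnA -[RHS]mulr_natr natrM mulrC expr2.
rewrite -sumrB (le_trans (ler_norm_sum _ _ _))//; apply: ler_sum => l _.
rewrite mean_sum; last by move=> ?; exact: bounded_fejer_term.
rewrite -sumrB (le_trans (ler_norm_sum _ _ _))//; apply: ler_sum => k _.
rewrite meanD; [|exact: bounded_mfunZ (bounded_circle_cos _)|
  exact: bounded_mfunZ (bounded_circle_sin _)].
rewrite meanZ; last exact: bounded_circle_cos.
rewrite meanZ; last exact: bounded_circle_sin.
have [<-|lk] := eqVneq l k.
  rewrite distnn; under eq_Rintegral do rewrite circle_cos0.
  under [X in _ + _ * X - _]eq_Rintegral do rewrite circle_sin0.
  rewrite !mean_cst mul0r mulr0 cos0 mulr0 addr0 mulr1 subrr normr0.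
  by rewrite mulr_ge0.
rewrite subr0; set a := `|l - k|%N.
have [|ca sa] := small a.
  rewrite lt0n distn_eq0 lk/= /a; have := ltn_ord k; have := ltn_ord l; lia.
have -> : 2 * e = 1 * e + 1 * e by ring.
rewrite (le_trans (ler_normD _ _))// lerD// normrM ler_pM//; first exact: cos_max.
exact: sin_max.
Qed.

End fourier.

(** * Convergence to Lebesgue measure *)

Section equidistribution.
Variable R : realType.
Implicit Types (mu nu : circle_prob R) (f : circle R -> R) (c : circle R).

Lemma circle_unif_continuous f e : continuous f -> 0 < e ->
  exists2 d, 0 < d & forall x y : R, `|x - y| < d ->
    `|f (circle_proj x) - f (circle_proj y)| < e.
Proof.
move=> cf e0; have cfp : continuous (f \o @circle_proj R).
  by move=> x; apply: continuous_comp; [exact: circle_proj_continuous|exact: cf].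
have [d d0 dP] := @segment_unif_continuous R _ 0 1 e cfp e0.
exists d => // x y xy; set n : R := (Num.floor x)%:~R.
have shift z : circle_proj z = circle_proj (z - n) :> circle R.
  by apply/circle_proj_eq; rewrite opprB addrC subrK intr_int.
rewrite (shift x) (shift y); apply: dP.
  rewrite subr_ge0 floor_le_tmp/= ltW//.
  by have := floorD1_gt x; rewrite ltrBlDl intrD.
by rewrite opprB addrA subrK.
Qed.

(** Weights of a partition of unity average the values of [f].  Grid points
close to [c] modulo 1 give values close to [f c]; the weights of the others are
O(m^-2), so that the [m] of them weigh O(1/m) altogether. *)
Lemma fejer_approx f e : continuous f -> 0 < e -> exists2 m : nat, (0 < m)%N &
  forall c, `|f c - \sum_(j < m) f (circle_proj (j%:R / m%:R : R)) *
                       fejer m (circle_lift c - j%:R / m%:R)| <= e.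
Proof.
move=> cf e0; have [_ [M fM]] := continuous_circle_bounded_mfun cf.
have M0 : 0 <= M by apply: le_trans (fM 0).
have [d' d'0 dP] := circle_unif_continuous cf (divr_gt0 e0 (ltr0Sn R 1)).
pose d : R := Num.min d' 2^-1.
have d0 : 0 < d by rewrite lt_min d'0 invr_gt0 ltr0n.
have d2 : d <= 2^-1 by rewrite ge_min lexx orbT.
have K0 := far_gap_gt0 d0 d2; set K := 1 - cos _ in K0.
have [m' mM] : exists m' : nat, 16 * M / (K ^+ 2 * e) < m'.+1%:R.
  by exists (Num.truncn (16 * M / (K ^+ 2 * e))); rewrite truncnS_gt.
exists m'.+1 => // c; set m := m'.+1.
have m0 : 0 < m%:R :> R by rewrite ltr0n.
set x := circle_lift c.
have -> : f c = \sum_(j < m) f c * fejer m (x - j%:R / m%:R).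
  by rewrite -mulr_sumr fejer_sum_translates// mulr1.
rewrite -sumrB (le_trans (ler_norm_sum _ _ _))//.
apply: (@le_trans _ _ (\sum_(j < m) (e / 2 * fejer m (x - j%:R / m%:R) +
    2 * M * (2 / (m%:R * K)) ^+ 2))).
  apply: ler_sum => j _; rewrite -mulrBl normrM (ger0_norm (fejer_ge0 _ _)).
  set y := j%:R / m%:R.
  have [[k xk]|far] := pselect (exists k : int, `|x - y - k%:~R| < d).
    rewrite -[leLHS]addr0 lerD//; last by apply: mulr_ge0; [rewrite mulr_ge0|exact: sqr_ge0].
    rewrite ler_wpM2r ?fejer_ge0// ltW// -(circle_liftK c) -/x.
    have -> : circle_proj y = circle_proj (y + k%:~R) :> circle R.
      by apply/circle_proj_eq; rewrite opprD addrA subrr sub0r rpredN intr_int.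
    apply: dP; rewrite opprD addrA (lt_le_trans xk)//.
    by rewrite ge_min lexx.
  rewrite -[leLHS]add0r lerD//; first by rewrite mulr_ge0 ?fejer_ge0// divr_ge0// ltW.
  apply: ler_pM; rewrite ?normr_ge0 ?fejer_ge0//.
    by rewrite (le_trans (ler_normB _ _))// mulr_natl mulr2n lerD.
  apply: fejer_far => // k; rewrite leNgt; apply/negP => xk.
  by apply: far; exists k.
rewrite big_split/= -mulr_sumr fejer_sum_translates// mulr1.
rewrite sumr_const card_ord -mulr_natr.
suff : 2 * M * (2 / (m%:R * K)) ^+ 2 * m%:R <= e / 2 by lra.
have -> : 2 * M * (2 / (m%:R * K)) ^+ 2 * m%:R = 8 * M / (K ^+ 2) / m%:R.
  by field; rewrite !gt_eqF.
rewrite ler_pdivrMr// ltW//; move: mM.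
rewrite ltr_pdivrMr ?mulr_gt0 ?exprn_gt0// ltr_pdivrMr ?exprn_gt0// -/m; lra.
Qed.

(** Integrating [fejer_approx] replaces the integral of [f] by [v], its mean
over the grid of step 1/m.  As [v] is the same for all measures, two measures
with small coefficients give nearly the same integral to [f]. *)
Lemma mean_approx f e : continuous f -> 0 < e ->
  exists m v, exists2 d, 0 < d & forall mu,
  (forall a, (0 < a < m)%N -> `|fourier_cos a mu| <= d /\ `|fourier_sin a mu| <= d) ->
  `|\int[mu]_x f x - v| <= e.
Proof.
move=> cf e0; have e20 : 0 < e / 2 by rewrite divr_gt0.
have [m m0 mP] := fejer_approx cf e20.
have m0' : 0 < m%:R :> R by rewrite ltr0n.
have [_ [M fM]] := continuous_circle_bounded_mfun cf.
have M0 : 0 <= M by apply: le_trans (fM 0).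
pose v := \sum_(j < m) f (circle_proj (j%:R / m%:R : R)) * m%:R^-1.
pose d := e / (4 * (M + 1) * m%:R).
have d0 : 0 < d by rewrite divr_gt0 ?mulr_gt0// ltr_wpDl.
exists m, v, d => // mu small.
pose P c := \sum_(j < m) f (circle_proj (j%:R / m%:R : R)) *
                       fejer m (circle_lift c - j%:R / m%:R).
have bP : bounded_mfun P.
  by apply: bounded_mfun_sum => j; apply: bounded_mfunZ; exact: bounded_fejer.
have h1 : `|\int[mu]_x f x - \int[mu]_x P x| <= e / 2.
  by apply: norm_meanB_le => //; exact: continuous_circle_bounded_mfun.
have h2 : `|\int[mu]_x P x - v| <= e / 2.
  rewrite mean_sum; last by move=> j; apply: bounded_mfunZ; exact: bounded_fejer.
  rewrite -sumrB (le_trans (ler_norm_sum _ _ _))//.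
  apply: (@le_trans _ _ (\sum_(j < m) (M + 1) * (2 * d))).
    apply: ler_sum => j _; rewrite meanZ; last exact: bounded_fejer.
    rewrite -mulrBr normrM ler_pM//; first by rewrite (le_trans (fM _))// lerDl.
    by apply: mean_fejer => //; exact: ltW.
  rewrite sumr_const card_ord -mulr_natr /d le_eqVlt; apply/orP; left.
  by apply/eqP; field; rewrite !gt_eqF// ltr_wpDl.
by rewrite -(subrKA (\int[mu]_x P x)) (splitr e) (le_trans (ler_normD _ _))// lerD.
Qed.

Lemma cdf_unit_lebesgue (y : R) : 0 <= y <= 1 -> cdf_real (@unit_lebesgue R) y = y.
Proof.
move=> /andP[y0 y1]; rewrite /cdf_real /= /unit_lebesgue /mrestr.
have [y1'|y1'] := ltP y 1.
  rewrite (_ : _ `&` _ = [set` `[0, y]]); last first.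
    apply/seteqP; split => t /=; rewrite !in_itv/=.
      by move=> [ty /andP[t0 t1]]; rewrite t0.
    by move=> /andP[t0 ty]; rewrite ty t0 (le_lt_trans ty).
  rewrite lebesgue_measure_itv/= lte_fin; case: ifPn => y0'/=.
    by rewrite oppr0 addr0.
  by apply/eqP; rewrite eq_le y0/= leNgt.
rewrite (_ : _ `&` _ = [set` `[0, 1[]); last first.
  apply/seteqP; split => t /=; rewrite !in_itv/=; first by case.
  by move=> /andP[t0 t1]; rewrite t0 t1 (le_trans (ltW t1)).
rewrite lebesgue_measure_itv/= lte_fin ltr01/= oppr0 addr0.
by apply/eqP; rewrite eq_le y1 y1'.
Qed.

(** The Riemann sums on more than [a] equal steps vanish exactly
([cos_sum_translates]).  The phase [x] covers cosines and sines at once. *)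
Lemma mean_unit_lebesgue_cos a (x : R) : (0 < a)%N ->
  \int[@unit_lebesgue R]_t cos (2 * pi * (a%:R * (x - t))) = 0.
Proof.
move=> a0; pose g (t : R) := cos (2 * pi * (a%:R * (x - t))).
have cg : continuous g.
  move=> t; apply: continuous_comp; last exact: continuous_cos.
  by do 2 apply: cvgMr; apply: cvgB; [exact: cvg_cst|exact: cvg_id].
have bg : bounded_mfun (g : measurableTypeR R -> R).
  split; first exact: continuous_measurable_fun.
  by exists 1 => t; exact: cos_max.
apply/eqP; rewrite -normr_le0; apply/ler_addgt0Pr => e e0; rewrite add0r.
have [d d0 dP] := @segment_unif_continuous R g 0 1 e cg e0.
pose m := maxn a.+1 (Num.truncn d^-1).+1.
have m0 : (0 < m)%N by rewrite /m; lia.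
have m0' : 0 < m%:R :> R by rewrite ltr0n.
pose y (i : nat) : R := i%:R / m%:R.
have ySB i : y i.+1 - y i = m%:R^-1.
  by rewrite /y -mulrBl -natr1 addrAC subrr add0r mul1r.
have y01 i : (i <= m)%N -> 0 <= y i <= 1.
  by move=> im; rewrite divr_ge0//= ler_pdivrMr// mul1r ler_nat.
have := @riemann_stieltjes R (@unit_lebesgue R) g m y (fun i => g (y i)) e bg.
have -> : \sum_(0 <= i < m) g (y i) * (cdf_real (@unit_lebesgue R) (y i.+1) -
    cdf_real (@unit_lebesgue R) (y i)) = 0.
  transitivity (\sum_(0 <= i < m) g (y i) * m%:R^-1).
    rewrite big_nat [RHS]big_nat; apply: eq_bigr => i /andP[_ im].
    by rewrite !cdf_unit_lebesgue ?y01// ?ySB// ltnW.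
  rewrite -mulr_suml big_mkord cos_sum_translates ?mul0r//.
  by rewrite a0 /m; lia.
rewrite subr0; apply.
- by move=> i j ij; rewrite ler_pM2r ?invr_gt0// ler_nat.
- by rewrite /y mul0r cdf_unit_lebesgue// lexx ler01.
- by rewrite /y mulfV ?gt_eqF// cdf_unit_lebesgue// lexx ler01.
- move=> i t im /andP[yt ty]; rewrite distrC ltW// dP// ?y01 1?ltnW//.
  rewrite ltr0_norm ?subr_lt0// opprB (le_lt_trans (lerD ty (lexx _)))// ySB.
  rewrite -[ltRHS]invrK ltf_pV2 ?posrE ?invr_gt0//.
  by rewrite (lt_le_trans (truncnS_gt _))// ler_nat leq_maxr.
Qed.

Lemma fourier_cos_Leb a : (0 < a)%N -> fourier_cos a (Leb R) = 0.
Proof.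
move=> a0; rewrite /fourier_cos mean_distribution; last exact: bounded_circle_cos.
rewrite -[RHS](@mean_unit_lebesgue_cos a 0)//; apply: eq_Rintegral => t _.
by rewrite circle_cos_proj sub0r !mulrN cosN.
Qed.

Lemma fourier_sin_Leb a : (0 < a)%N -> fourier_sin a (Leb R) = 0.
Proof.
move=> a0; rewrite /fourier_sin mean_distribution; last exact: bounded_circle_sin.
have a0' : a%:R != 0 :> R by rewrite pnatr_eq0 -lt0n.
rewrite -[RHS](@mean_unit_lebesgue_cos a (4 * a%:R)^-1)//.
apply: eq_Rintegral => t _; rewrite circle_sin_proj -cosBpihalf -[RHS]cosN.
by congr cos; field.
Qed.

Definition fourier_small (k : nat) : set (circle_prob R) :=
  [set mu | forall a, (0 < a <= k)%N ->
    `|fourier_cos a mu| < k.+1%:R^-1 /\ `|fourier_sin a mu| < k.+1%:R^-1].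

Lemma fourier_small_mono j k : (j <= k)%N -> fourier_small k `<=` fourier_small j.
Proof.
move=> jk mu small a /andP[a0 aj].
have [|ca sa] := small a; first by rewrite a0 (leq_trans aj).
have kj : k.+1%:R^-1 <= j.+1%:R^-1 :> R by rewrite lef_pV2 ?posrE// ler_nat.
by split; exact: lt_le_trans kj.
Qed.

(** The coefficients of Lebesgue measure vanish, so [mean_approx] compares
the integrals of a continuous function against [mu] and Lebesgue measure. *)
Lemma fourier_small_nbhs (V : set (circle_prob R)) :
  nbhs (Leb R) V -> exists k, fourier_small k `<=` V.
Proof.
pose F := filter_from [set: nat] fourier_small.
have FF : Filter F.
  apply: filter_from_filter; first by exists 0%N.
  move=> i j _ _; exists (maxn i j) => // mu small.
  by split; apply: fourier_small_mono small; rewrite ?leq_maxl ?leq_maxr.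
suff FL : F --> Leb R by move=> /FL [k _ kV]; exists k.
apply/cvg_circle_prob => f; have cf : continuous f := @cts_fun _ _ f.
apply/cvgrPdist_le => e e0; have e20 : 0 < e / 2 by rewrite divr_gt0.
have [m [v [d d0 mP]]] := mean_approx cf e20.
exists (maxn m (Num.truncn d^-1)) => // mu small.
rewrite -(subrKA v) (splitr e) (le_trans (ler_normD _ _))// lerD//.
  apply: mP => a /andP[a0 _].
  by rewrite fourier_cos_Leb// fourier_sin_Leb// normr0 ltW.
rewrite distrC; apply: mP => a /andP[a0 am].
have [|ca sa] := small a; first by rewrite a0 (leq_trans (ltnW am))// leq_maxl.
have kd : (maxn m (Num.truncn d^-1)).+1%:R^-1 <= d.
  rewrite -[leRHS]invrK lef_pV2 ?posrE ?invr_gt0//.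
  rewrite ltW// (lt_le_trans (truncnS_gt _))// ler_nat ltnS leq_maxr//.
by split; apply: ltW; exact: lt_le_trans kd.
Qed.

(** The Fejer kernel centred at [x] dominates the indicator function of [x],
and its integral is at most 1/(k+1) + 2/(k+1). *)
Lemma fourier_small_atom k mu x : fourier_small k mu ->
  fine (mu [set x]) <= 3 * k.+1%:R^-1.
Proof.
move=> small; have mx := measurable_circle1 x.
have -> : fine (mu [set x]) = \int[mu]_c \1_[set x] c.
  by rewrite /Rintegral integral_indic// setIT.
have f0 : fejer k.+1 (0 : R) = 1.
  rewrite /fejer; under eq_bigr do rewrite mulr0 cis0.
  rewrite sumr_const card_ord normcMn ComplexField.Normc.normc1.
  by rewrite mulfV ?expr1n.
apply: (@le_trans _ _ (\int[mu]_c fejer k.+1 (circle_lift c - circle_lift x))).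
  apply: le_mean; [|exact: bounded_fejer|].
    split; first exact: measurable_indic.
    by exists 1 => c; rewrite indicE ger0_norm// lern1 leq_b1.
  move=> c; rewrite indicE; have [|_] := boolP (c \in [set x]).
    by rewrite inE => /= ->; rewrite subrr f0.
  exact: fejer_ge0.
have := @mean_fejer R mu k.+1 (circle_lift x) k.+1%:R^-1 (ltn0Sn _).
have k0 : 0 <= k.+1%:R^-1 :> R by rewrite invr_ge0.
move=> /(_ k0) h.
suff /h : forall a, (0 < a < k.+1)%N -> `|fourier_cos a mu| <= k.+1%:R^-1 /\
    `|fourier_sin a mu| <= k.+1%:R^-1.
  by move=> /ler_normlW; set I := Rintegral _ _ _; set r := _^-1; clear; lra.
by move=> a /small [ca sa]; split; exact: ltW.
Qed.

End equidistribution.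

(** * Averages of image measures *)

Section average.
Variables (R : realType) (I : finType) (i0 : I).
Variables (nu : circle_prob R) (h : I -> {mfun circle R >-> circle R}).

Let image_measure (k : nat) : {measure set (circle R) -> \bar R} :=
  distribution (nu : probability _ _) (h (nth i0 (enum I) k)).

Let card_gt0 : (0 < #|I|)%N.
Proof. by apply/card_gt0P; exists i0. Qed.

Let r_ge0 : (0 <= #|I|%:R^-1 :> R).
Proof. by rewrite invr_ge0. Qed.

Let average := mscale (NngNum r_ge0) (msum image_measure #|I|).

HB.instance Definition _ := Measure.on average.

Let image_measureT k : image_measure k setT = 1%E.
Proof.
exact: (@probability_setT _ _ _
  (distribution (nu : probability _ _) (h (nth i0 (enum I) k)))).
Qed.

Let averageT : average setT = 1%E.
Proof.
rewrite /average /mscale /= /msum.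
under eq_bigr do rewrite image_measureT.
rewrite sumEFin sumr_const card_ord -EFinM mulVf//.
by rewrite pnatr_eq0 -lt0n.
Qed.

HB.instance Definition _ := Measure_isProbability.Build _ _ _ average averageT.

(** The average over [I] of the images of [nu] under the maps [h i],
characterised by its integrals. *)
Lemma average_image : exists mu : circle_prob R,
  forall f, bounded_mfun f ->
    \int[mu]_c f c = #|I|%:R^-1 * \sum_i \int[nu]_c f (h i c).
Proof.
exists average => f bf.
(* For nonnegative functions, integrals against sums and multiples of measures
   can be computed termwise; a constant added to [f] makes it nonnegative. *)
have ge0_case g : bounded_mfun g -> (forall c, 0 <= g c) ->
    \int[average]_c g c = #|I|%:R^-1 * \sum_i \int[nu]_c g (h i c).
  move=> bg g0; have mg : measurable_fun setT (EFin \o g).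
    by apply/measurable_EFinP; case: bg.
  rewrite {1}/Rintegral ge0_integral_mscale//=; last by move=> c _; rewrite lee_fin.
  rewrite ge0_integral_measure_sum//; last by move=> c _; rewrite lee_fin.
  transitivity (fine ((#|I|%:R^-1)%:E *
      \sum_(k < #|I|) (\int[nu]_c g (h (nth i0 (enum I) k) c))%:E)%E).
    congr (fine (_ * _)%E); apply: eq_bigr => k _.
    rewrite -mean_distribution// /Rintegral fineK//.
    by apply: integrable_fin_num => //; exact: bounded_mfun_integrable.
  rewrite sumEFin -EFinM/=; congr (_ * _).
  rewrite -[RHS]big_enum/= (big_nth i0) big_mkord -cardE.
  exact: eq_bigr.
have [_ [M fM]] := bf.
have bM := @bounded_mfun_cst _ (circle R) R M.
have bhf i : bounded_mfun (fun c => f (h i c)).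
  exact: (@bounded_mfun_comp _ _ _ _ _ (h i) f).
have := ge0_case (fun c => f c + M) (bounded_mfunD bf bM).
have -> : \sum_i \int[nu]_c (f (h i c) + M) = \sum_i \int[nu]_c f (h i c) + #|I|%:R * M.
  under eq_bigr do rewrite meanD// mean_cst.
  by rewrite big_split/= sumr_const mulr_natl.
rewrite meanD// mean_cst mulrDr mulrA mulVf ?pnatr_eq0 -?lt0n// mul1r.
move=> H; apply: (addIr M); apply: H => c.
by have := fM c; rewrite ler_norml => /andP[+ _]; lra.
Qed.

End average.

(** * Invariant measures shadowing a given one *)

Section shadow.
Variables (R : realType) (p : nat).
Hypothesis p_ge2 : (2 <= p)%N.

(** The estimate satisfied by an average over orbit segments of length [L] that
follow orbits distributed according to [nu] within (p + C) / p^r, except during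
the last [r] steps: [e] bounds the oscillation of [f] at the scale [d], and the
last steps cost at most [2 * M] each. *)
Definition shadow (C : R) (L : nat) (nu : circle_prob R) : set (circle_prob R) :=
  [set mu | forall (f : circle R -> R) (d e M : R) (r : nat),
    continuous f -> 0 <= e ->
    (forall x y : R, `|x - y| < d -> `|f (circle_proj x) - f (circle_proj y)| <= e) ->
    (forall c, `|f c| <= M) -> (p%:R + C) / p%:R ^+ r < d ->
    `|\int[mu]_c f c - \int[nu]_c f c| <= e + 2 * M * (r%:R / L%:R)].

(** Choose [r] to bring the distance below the scale at which [f] is nearly
constant, and then [L] large compared with [r]. *)
Lemma shadow_nbhs C nu (V : set (circle_prob R)) : 0 <= C -> nbhs nu V ->
  exists L0, forall L, (L0 <= L)%N -> shadow C L nu `<=` V.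
Proof.
move=> C0; pose F := filter_from [set: nat]
  (fun L0 => [set mu | exists2 L, (L0 <= L)%N & shadow C L nu mu]).
have FF : Filter F.
  apply: filter_from_filter; first by exists 0%N.
  move=> i j _ _; exists (maxn i j) => // mu [L]; rewrite geq_max => /andP[iL jL] sh.
  by split; exists L.
suff FL : F --> nu.
  by move=> /FL [L0 _ LV]; exists L0 => L LL mu sh; apply: LV; exists L.
apply/cvg_circle_prob => f; have cf : continuous f := @cts_fun _ _ f.
have [_ [M fM]] := continuous_circle_bounded_mfun cf.
have M0 : 0 <= M by apply: le_trans (fM 0).
apply/cvgrPdist_le => e e0; have e20 : 0 < e / 2 by rewrite divr_gt0.
have [d d0 dP] := circle_unif_continuous cf e20.
have p0 : 0 < p%:R :> R by rewrite ltr0n; lia.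
have [r rd] : exists r, (p%:R + C) / p%:R ^+ r < d.
  exists (Num.truncn ((p%:R + C) / d)).+1; set r := _.+1.
  rewrite ltr_pdivrMr ?exprn_gt0// mulrC -ltr_pdivrMr//.
  apply: (lt_le_trans (truncnS_gt _)); rewrite -/r -natrX ler_nat ltnW//.
  exact: ltn_expl.
have r0 : 0 <= r%:R :> R by [].
exists (Num.truncn (4 * M * r%:R / e)).+1 => // mu [L LL sh].
have L0 : 0 < L%:R :> R by rewrite ltr0n; lia.
rewrite distrC; apply: le_trans (sh f d (e / 2) M r cf _ _ fM rd) _.
- exact: ltW.
- by move=> x y /dP /ltW.
rewrite [leRHS]splitr lerD2l mulrA ler_pdivrMr//.
have : 4 * M * r%:R / e < L%:R by rewrite (lt_le_trans (truncnS_gt _))// ler_nat.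
by rewrite ltr_pdivrMr//; lra.
Qed.

Variables (L m : nat).
Hypotheses (L_gt0 : (0 < L)%N) (m_gt0 : (0 < m)%N).
Hypotheses (pLm : (m %| p ^ L - 1)%N) (m_large : (p ^ L <= p * m)%N).

Definition grid_point (x : R) : R := (Num.floor (m%:R * x))%:~R / m%:R.

Let m0 : 0 < m%:R :> R. Proof. by rewrite ltr0n. Qed.

Let p0 : 0 < p%:R :> R. Proof. by rewrite ltr0n; lia. Qed.

Lemma grid_point_le x : grid_point x <= x.
Proof. by rewrite ler_pdivrMr// mulrC floor_le_tmp. Qed.

Lemma grid_point_gt x : x - grid_point x <= m%:R^-1.
Proof.
rewrite -(ler_pM2l m0) mulrBr mulfV ?gt_eqF// /grid_point mulrCA mulfV ?gt_eqF// mulr1.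
by have := floorD1_gt (m%:R * x); rewrite intrD => /ltW; rewrite lerBlDl.
Qed.

Definition grid (c : circle R) : circle R := circle_proj (grid_point (circle_lift c)).

Lemma grid_int n c : (m %| n)%N -> n%:R * grid_point (circle_lift c) \is a Num.int.
Proof.
move=> /dvdnP[k ->]; rewrite natrM /grid_point -mulrA [m%:R * (_ / _)]mulrCA.
by rewrite mulfV ?gt_eqF// mulr1 rpredM ?rpred_nat ?intr_int.
Qed.

(** Grid points are k/m, and n = 1 modulo m. *)
Lemma grid_fixed n c : (0 < n)%N -> (m %| n - 1)%N -> grid c *+ n = grid c.
Proof.
move=> n0 /(grid_int c) gi; rewrite -circle_projMn; apply/circle_proj_eq.
rewrite -mulr_natl; move: gi; rewrite natrB// mulrBl mul1r.
by [].
Qed.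

Lemma measurable_grid : measurable_fun setT grid.
Proof.
apply: (measurableT_comp (@circle_proj_measurable R)).
apply: (measurableT_comp (f := grid_point) _ (@measurable_circle_lift R)).
apply: nondecreasing_measurable => // x y xy.
by rewrite ler_pM2r ?invr_gt0// ler_int le_floor// ler_pM2l.
Qed.

Variables (Xi : finType) (xi0 : Xi) (s : Xi -> Xi) (Y : Xi -> R) (C : R).
Hypotheses (s_inj : injective s).
Hypothesis Y_bound : forall xi, 0 <= Y xi <= C / p%:R ^+ L.
Hypothesis Y_shift : forall xi, circle_proj (Y xi *+ (p ^ L)) = circle_proj (Y (s xi)).

Definition grid_image (n : nat) (xi : Xi) (c : circle R) : circle R :=
  circle_times n (grid c + circle_proj (Y xi)).

Lemma measurable_grid_image n xi : measurable_fun setT (grid_image n xi).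
Proof.
apply: measurableT_comp; first exact: circle_times_measurable.
exact: (measurableT_comp (continuous_circle_measurable
  (@circle_continuousT R (circle_proj (Y xi)))) measurable_grid).
Qed.

Lemma grid_image_proj n xi c : grid_image n xi c =
  circle_proj (n%:R * (grid_point (circle_lift c) + Y xi)).
Proof. by rewrite /grid_image -circle_projD circle_times_proj mulr_natl. Qed.

Lemma grid_image_shift n xi c : grid_image (p ^ L * n) xi c = grid_image n (s xi) c.
Proof.
rewrite /grid_image /circle_times mulrnA; congr (_ *+ _).
rewrite mulrnDl -Y_shift circle_projMn grid_fixed// expn_gt0.
by rewrite (leq_trans _ p_ge2).
Qed.

Lemma grid_image_times k n xi c : circle_times k (grid_image n xi c) = grid_image (n * k) xi c.
Proof. by rewrite /grid_image /circle_times mulrnA. Qed.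

(** The measure is the average, over [j < L] and over the offsets, of the
images of [nu] under [grid_image (p ^ j)].  Applying T_p turns [j] into [j + 1],
and at [j = L] it leads back to [j = 0] with the offsets permuted by [s].  The
initial error is at most 1/m + C / p^L <= (p + C) / p^L, and T_p multiplies it
by [p] at each step. *)
Lemma grid_measure (nu : circle_prob R) : invariant_prob R p nu ->
  exists mu, [/\ invariant_prob R p mu, shadow C L nu mu &
    forall f, bounded_mfun f -> \int[mu]_c f c =
      (L * #|Xi|)%:R^-1 *
        \sum_(j < L) \sum_xi \int[nu]_c f (grid_image (p ^ j) xi c)].
Proof.
move=> nu_inv.
pose h (i : 'I_L * Xi) : {mfun circle R >-> circle R} :=
  HB.pack_for {mfun circle R >-> circle R} (grid_image (p ^ i.1) i.2)
    (isMeasurableFun.Build _ _ _ _ (grid_image (p ^ i.1) i.2)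
       (@measurable_grid_image _ _)).
have [mu muE] := average_image (Ordinal L_gt0, xi0) nu h.
exists mu.
have {}muE f : bounded_mfun f -> \int[mu]_c f c = (L * #|Xi|)%:R^-1 *
        \sum_(j < L) \sum_xi \int[nu]_c f (grid_image (p ^ j) xi c).
  by move=> bf; rewrite muE// card_prod card_ord pair_big.
split=> //.
  apply/invariant_probP => f cf.
  have bf := continuous_circle_bounded_mfun cf.
  rewrite !muE//; last exact/continuous_circle_bounded_mfun/continuous_comp_times.
  congr (_ * _); pose G j := \sum_xi \int[nu]_c f (grid_image (p ^ j) xi c).
  have -> : \sum_(j < L) \sum_xi
      \int[nu]_c f (circle_times p (grid_image (p ^ j) xi c)) = \sum_(j < L) G j.+1.
    apply: eq_bigr => j _; apply: eq_bigr => xi _; apply: eq_Rintegral => c _.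
    by rewrite grid_image_times -expnSr.
  have GL : G L = G 0%N.
    rewrite /G [RHS](reindex_inj s_inj)/=; apply: eq_bigr => xi _.
    by apply: eq_Rintegral => c _; rewrite -grid_image_shift expn0 muln1.
  rewrite -(big_mkord xpredT (fun j => G j.+1)) -(big_mkord xpredT G).
  apply/eqP; rewrite -subr_eq0 -sumrB telescope_sumr//.
  by rewrite GL subrr.
move=> f d e M r cf e0 fd fM rd.
have bf := continuous_circle_bounded_mfun cf.
have M0 : 0 <= M by apply: le_trans (fM 0).
have L0 : 0 < L%:R :> R by rewrite ltr0n.
have Xi_gt0 : (0 < #|Xi|)%N by apply/card_gt0P; exists xi0.
have X0 : 0 < #|Xi|%:R :> R by rewrite ltr0n.
have nuE j : \int[nu]_c f c = \int[nu]_c f (circle_times (p ^ j) c).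
  elim: j => [|j IHj]; first by apply: eq_Rintegral => c _; rewrite /circle_times expn0.
  rewrite IHj -(iffLR (invariant_probP p nu) nu_inv _ (continuous_comp_times (n := p ^ j) cf)).
  by apply: eq_Rintegral => c _; rewrite /circle_times -mulrnA -expnS.
have -> : \int[nu]_c f c = (L * #|Xi|)%:R^-1 *
    \sum_(j < L) \sum_(xi : Xi) \int[nu]_c f (circle_times (p ^ j) c).
  under eq_bigr do under eq_bigr do rewrite -nuE.
  rewrite !sumr_const card_ord -mulrnA mulnC -[X in _ * X]mulr_natl mulrA mulVf ?mul1r//.
  by rewrite pnatr_eq0 -lt0n muln_gt0 Xi_gt0.
rewrite muE// -mulrBr normrM ger0_norm ?invr_ge0//.
rewrite ler_pdivrMl ?ltr0n ?muln_gt0 ?L_gt0//.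
rewrite -sumrB (le_trans (ler_norm_sum _ _ _))//.
apply: (@le_trans _ _ (\sum_(j < L) \sum_(xi : Xi)
    (e + 2 * M * (L < j + r)%N%:R))).
  apply: ler_sum => j _; rewrite -sumrB (le_trans (ler_norm_sum _ _ _))//.
  apply: ler_sum => xi _; apply: norm_meanB_le.
  - exact: (bounded_mfun_comp (@measurable_grid_image (p ^ j) xi) bf).
  - exact: (bounded_mfun_comp (@circle_times_measurable R (p ^ j)) bf).
  - move=> c; case: ltnP => [_|jr]; rewrite ?mulr1 ?mulr0 ?addr0.
      rewrite -[leLHS]add0r lerD// (le_trans (ler_normB _ _))//.
      by rewrite mulr_natl mulr2n lerD.
    rewrite grid_image_proj -[c in circle_times _ c](circle_liftK c).
    rewrite circle_times_proj -(mulr_natl (circle_lift c)); apply: fd.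
    set x := circle_lift c; set g := grid_point x.
    have gx : g <= x := grid_point_le x.
    have xg : x - g <= m%:R^-1 := grid_point_gt x.
    have /andP[Y0 YC] := Y_bound xi.
    rewrite -mulrBr normrM normr_nat.
    have -> : g + Y xi - x = Y xi - (x - g) by ring.
    apply: (@le_lt_trans _ _ ((p ^ j)%:R * ((p%:R + C) / p%:R ^+ L))).
      rewrite ler_wpM2l// (le_trans (ler_normB _ _))// mulrDl addrC.
      rewrite (ger0_norm Y0) ger0_norm ?subr_ge0// lerD//.
      apply: (le_trans xg); rewrite ler_pdivlMr ?exprn_gt0// mulrC.
      by rewrite ler_pdivrMr// -natrX -natrM ler_nat.
    apply: le_lt_trans rd; rewrite natrX mulrCA.
    rewrite ler_wpM2l//.
      by rewrite addr_ge0 ?(ltW p0)//; have := le_trans Y0 YC; rewrite pmulr_lge0// invr_gt0 exprn_gt0.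
    rewrite ler_pdivrMr ?exprn_gt0// mulrC ler_pdivlMr ?exprn_gt0//.
    by rewrite -exprD -!natrX ler_nat leq_exp2l.
rewrite (eq_bigr (fun j : 'I_L => #|Xi|%:R * e + #|Xi|%:R * (2 * M) * (L < j + r)%N%:R)); last first.
  by move=> j _; rewrite sumr_const -[LHS]mulr_natl mulrDr mulrA.
rewrite big_split/= sumr_const card_ord -mulr_sumr -[X in X + _]mulr_natl natrM.
have cnt : \sum_(j < L) (L < j + r)%N%:R <= r%:R :> R.
  rewrite -natr_sum ler_nat.
  have H k : (\sum_(j < k) (L < j + r) <= k + r - L)%N.
    elim: k => [|k IHk]; first by rewrite big_ord0.
    rewrite big_ord_recr/=; move: IHk; set S := (\sum_(j < k) _)%N; clearbody S.
    by case: ltnP => /= ? ?; lia.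
  by apply: leq_trans (H L) _; rewrite addnC addnK.
have -> : L%:R * #|Xi|%:R * (e + 2 * M * (r%:R / L%:R)) =
    L%:R * (#|Xi|%:R * e) + #|Xi|%:R * (2 * M) * r%:R.
  by field; rewrite gt_eqF.
by rewrite lerD2l ler_wpM2l// !mulr_ge0.
Qed.

End shadow.

(** * Leading digits and orbits of irrational rotations *)

Section rotation.
Variable R : realType.
Local Notation normc := (@ComplexField.Normc.normc R).

Lemma cos_orbit_bound (b c : R) (N : nat) : b \isn't a Num.int ->
  \sum_(n < N) cos (2 * pi * (n%:R * b + c)) <= 2 / normc (1 - cis b).
Proof.
move=> bZ; have nb : 0 < normc (1 - cis b).
  have [d d0 [d2 bd]] := far_int bZ.
  exact: lt_le_trans (far_gap_gt0 d0 d2) (cis_far d0 d2 bd).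
rewrite ler_pdivlMr//; apply: le_trans (cis_geometric b N).
rewrite ler_wpM2r ?(ltW nb)//.
have -> : \sum_(n < N) cos (2 * pi * (n%:R * b + c)) =
    complex.Re (cis c * \sum_(n < N) cis (n%:R * b)).
  by rewrite mulr_sumr Re_sum; apply: eq_bigr => n _; rewrite -cisD addrC.
rewrite (le_trans (ler_norm _))// (le_trans (le_Re_normc _))//.
by rewrite ComplexField.Normc.normcM normc_cis mul1r.
Qed.

(** The constant term of the kernel gives N/m.  At every other frequency the
sum along the orbit is a geometric sum of ratio different from 1, bounded
independently of [N] and of the phase [c]. *)
Lemma fejer_orbit (alpha : R) (m : nat) : (0 < m)%N ->
  (forall d, (0 < d)%N -> d%:R * alpha \isn't a Num.int) ->
  exists2 B, 0 <= B & forall N c,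
    \sum_(n < N) fejer m (n%:R * alpha + c) <= N%:R / m%:R + B.
Proof.
move=> m0 irr; have m0' : 0 < m%:R :> R by rewrite ltr0n.
pose b d : R := if d == 0%N then 0 else 2 / normc (1 - cis (d%:R * alpha)).
have nc := @normc_ge0 R.
have b0 d : 0 <= b d by rewrite /b; case: ifP => // _; rewrite divr_ge0.
pose B := m%:R ^- 2 * \sum_(l < m) \sum_(k < m) b `|l - k|%N.
exists B.
  by rewrite mulr_ge0 ?invr_ge0 ?exprn_ge0//; do 2 apply: sumr_ge0 => ? _.
move=> N c; under eq_bigr do rewrite fejerE.
rewrite -mulr_sumr exchange_big/=.
have -> : N%:R / m%:R = m%:R ^- 2 * \sum_(l < m) \sum_(k < m) (l == k)%:R * N%:R :> R.
  under eq_bigr => l _.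
    rewrite (bigD1 l)//= big1 ?addr0 ?eqxx ?mul1r; last first.
      by move=> k; rewrite eq_sym => /negPf ->; rewrite mul0r.
    over.
  by rewrite sumr_const card_ord -(mulr_natl (N%:R : R) m); field; rewrite gt_eqF.
rewrite -mulrDr ler_wpM2l ?invr_ge0 ?exprn_ge0//.
rewrite -big_split/=; apply: ler_sum => l _; rewrite exchange_big -big_split/=.
apply: ler_sum => k _; have [<-|lk] := eqVneq l k.
  rewrite distnn mul1r; under eq_bigr do rewrite mul0r mulr0 cos0.
  by rewrite sumr_const card_ord lerDl.
rewrite mul0r add0r /b distn_eq0 (val_eqE l k) (negPf lk).
have -> : \sum_(n < N) cos (2 * pi * (`|l - k|%N%:R * (n%:R * alpha + c))) =
    \sum_(n < N) cos (2 * pi * (n%:R * (`|l - k|%N%:R * alpha) + `|l - k|%N%:R * c)).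
  by apply: eq_bigr => n _; congr (cos (_ * _)); rewrite mulrDr mulrCA.
by apply: cos_orbit_bound; apply: irr; rewrite lt0n distn_eq0.
Qed.

Lemma ln_le_sub1 (x : R) : 0 < x -> ln x <= x - 1.
Proof.
move=> x0; have := @le_ln1Dx R (x - 1); have -> : 1 + (x - 1) = x by ring.
by apply; lra.
Qed.

Lemma ln_ge_half (x : R) : 2 <= x -> 2^-1 <= ln x.
Proof.
move=> x2; have x0 : 0 < x by lra.
have := @ln_le_sub1 x^-1; rewrite invr_gt0 x0 lnV ?posrE// => /(_ isT).
have : x^-1 <= 2^-1 by rewrite lef_pV2 ?posrE//; lra.
by lra.
Qed.

Lemma harmonic_le (V : nat) : (0 < V)%N ->
  \sum_(v < V) v.+1%:R^-1 <= 1 + ln (V%:R : R).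
Proof.
elim: V => // -[_ _|V IHV _]; first by rewrite big_ord_recr big_ord0/= ln1 invr1 add0r addr0.
rewrite big_ord_recr/=; apply: (@le_trans _ _ (1 + ln V.+1%:R + V.+2%:R^-1)).
  by rewrite lerD2r IHV.
rewrite -addrA lerD2l -lerBrDl.
have V1 : 0 < V.+1%:R :> R by rewrite ltr0n.
have V2 : 0 < V.+2%:R :> R by rewrite ltr0n.
have := @ln_le_sub1 (V.+1%:R / V.+2%:R); rewrite divr_gt0// => /(_ isT).
rewrite ln_div ?posrE// => h.
have e : V.+1%:R / V.+2%:R - 1 = - V.+2%:R^-1 :> R.
  by rewrite -{1}[V.+1%:R](addrK 1) natr1 mulrBl divff ?gt_eqF// mul1r addrAC subrr add0r.
by rewrite e in h; move: h; rewrite lerBlDl -lerBlDr opprK lerBrDl addrC.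
Qed.

Lemma ln_near (s v d : R) : 1 <= v -> 0 < d <= 2^-1 -> `|s - v| < d ->
  `|ln s - ln v| <= 2 * d / v.
Proof.
move=> v1 /andP[d0 d2]; rewrite ltr_norml => /andP[sv1 sv2].
have v0 : 0 < v by lra.
have s0 : 0 < s by lra.
have h1 : ln s - ln v <= (s - v) / v.
  rewrite -ln_div ?posrE//; apply: le_trans (ln_le_sub1 _) _; first by rewrite divr_gt0.
  by rewrite mulrBl divff ?gt_eqF.
have h2 : ln v - ln s <= (v - s) / s.
  rewrite -ln_div ?posrE//; apply: le_trans (ln_le_sub1 _) _; first by rewrite divr_gt0.
  by rewrite mulrBl divff ?gt_eqF.
have h3 : (s - v) / v <= 2 * d / v by rewrite ler_pM2r ?invr_gt0//; lra.
have h4 : (v - s) / s <= 2 * d / v.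
  by rewrite ler_pdivrMr// mulrAC ler_pdivlMr//; nra.
by rewrite ler_norml; apply/andP; split; lra.
Qed.

(** If [s] is within [d] of the integer v, then ln s / ln Q is within
2 d / (v ln Q) of ln v / ln Q ([ln_near]), where a kernel of order about
v ln Q / d centred at ln v / ln Q is at least 1/4.  By [fejer_orbit] the inverses
of these orders bound the frequency with which an equidistributed orbit is
detected.  Their sum is O(d) uniformly in [Q], since the sum of the 1/v for
v <= Q is at most 1 + ln Q.  The index [v] stands for the integer [v.+1]; the
integer [Q] is included because [s] may approach [Q] from below. *)
Lemma near_int_detect (Q : nat) (d : R) : (2 <= Q)%N -> 0 < d <= 32^-1 ->
  exists m : nat -> nat, [/\ forall v, (0 < m v)%N,
    \sum_(v < Q) (m v)%:R^-1 <= 96 * d &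
    forall s : R, 1 <= s < Q%:R -> (exists k : int, `|s - k%:~R| < d) ->
      1 <= 4 * \sum_(v < Q)
        fejer (m v) (ln s / ln Q%:R - ln (v.+1%:R : R) / ln Q%:R)].
Proof.
move=> Q2 /andP[d0 d32].
have Q2' : 2 <= Q%:R :> R by rewrite (ler_nat R 2).
set l := ln (Q%:R : R); have l2 : 2^-1 <= l := ln_ge_half Q2'.
have l0 : 0 < l by lra.
pose m v := Num.truncn (v.+1%:R * l / (16 * d)).
have x1 v : 1 <= v.+1%:R * l / (16 * d) :> R.
  rewrite ler_pdivlMr ?mulr_gt0// mul1r.
  have : 1 <= v.+1%:R :> R by rewrite ler1n.
  by nra.
have mle v : (m v)%:R <= v.+1%:R * l / (16 * d) :> R.
  by rewrite truncn_le// (le_trans _ (x1 v)).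
have mge v : v.+1%:R * l / (16 * d) <= 2 * (m v)%:R :> R.
  have := truncnS_gt (v.+1%:R * l / (16 * d)); rewrite -/(m v) -natr1 => h.
  have : 1 <= (m v)%:R :> R.
    by rewrite ler1n truncn_gt0.
  lra.
have m0 v : (0 < m v)%N by rewrite truncn_gt0.
have m0' v : 0 < (m v)%:R :> R by rewrite ltr0n.
exists m; split=> //.
  apply: (@le_trans _ _ (\sum_(v < Q) (32 * d / l) * v.+1%:R^-1)).
    apply: ler_sum => v _.
    have v0 : 0 < v.+1%:R :> R by rewrite ltr0n.
    have -> : 32 * d / l / v.+1%:R = (v.+1%:R * l / (32 * d))^-1.
      by field; rewrite ?gt_eqF// mulr_gt0.
    rewrite lef_pV2 ?posrE ?divr_gt0 ?mulr_gt0// ler_pdivrMr ?mulr_gt0//.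
    by have := mge v; rewrite ler_pdivrMr ?mulr_gt0//; lra.
  rewrite -mulr_sumr; have Q0 : (0 < Q)%N by lia.
  have := harmonic_le Q0; rewrite -/l => h.
  have dl : 0 < 32 * d / l by rewrite divr_gt0// mulr_gt0.
  apply: (@le_trans _ _ (32 * d / l * (1 + l))); first by rewrite ler_pM2l.
  by rewrite mulrAC ler_pdivrMr//; nra.
move=> s /andP[s1 sQ] [k sk].
have d2 : 0 < d <= 2^-1 by rewrite d0/=; lra.
have k0 : (0 < k)%R.
  rewrite -(ltr_int R); move: sk; rewrite ltr_norml => /andP[? ?]; lra.
have kQ : (k%:~R : R) < Q%:R + 1.
  by move: sk; rewrite ltr_norml => /andP[? ?]; lra.
case: k k0 sk kQ => // k k0 sk kQ.
have {}k0 : (0 < k)%N by [].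
have kQ' : (k.-1 < Q)%N.
  by move: kQ; rewrite -[k%:~R]/(k%:R) natr1 ltr_nat; lia.
rewrite (bigD1 (Ordinal kQ'))//= prednK//.
have near : 4^-1 <= fejer (m k.-1) (ln s / l - ln (k%:R : R) / l).
  apply: fejer_near => //; rewrite -mulrBl normrM [X in _ * X]gtr0_norm ?invr_gt0//.
  rewrite ler_pdivrMr//.
  have k1 : 1 <= k%:R :> R by rewrite ler1n.
  apply: le_trans (ln_near k1 d2 sk) _.
  have := mle k.-1; rewrite prednK// ler_pdivlMr ?mulr_gt0// => h.
  have k0' : 0 < k%:R :> R by rewrite ltr0n.
  have mk : 0 < 8 * (m k.-1)%:R :> R by rewrite mulr_gt0.
  by rewrite ler_pdivrMr// -mulrA ler_pdivlMl//; lra.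
have rest : 0 <= \sum_(i < Q | i != Ordinal kQ')
    fejer (m i) (ln s / l - ln (i.+1%:R : R) / l).
  by apply: sumr_ge0 => i _; exact: fejer_ge0.
by rewrite mulrDr; lra.
Qed.

End rotation.

(** * Periodic sequences of independent digits *)

Section digits.
Variables (R : realType).
Local Notation normc := (@ComplexField.Normc.normc R).

(** The modulus of the Fourier transform of a uniform digit below [P]. *)
Definition digit_mean (P : nat) (s : R) : R :=
  normc (\sum_(b < P) cis (b%:R * s)) / P%:R.

Lemma digit_mean_le1 P s : digit_mean P s <= 1.
Proof.
have [->|P0] := posnP P; first by rewrite /digit_mean invr0 mulr0 ler01.
rewrite ler_pdivrMr ?ltr0n// mul1r (le_trans (normc_sum _ _))//.
by under eq_bigr do rewrite normc_cis; rewrite sumr_const card_ord.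
Qed.

Lemma digit_mean_far P s d : (0 < P)%N -> 0 < d -> d <= 2^-1 ->
  (forall k : int, d <= `|s - k%:~R|) ->
  digit_mean P s <= 2 / (P%:R * (1 - cos (2 * pi * d))).
Proof.
move=> P0 d0 d2 sk; have K0 := far_gap_gt0 d0 d2.
have P0' : 0 < P%:R :> R by rewrite ltr0n.
rewrite ler_pdivrMr// invfM mulrA mulrAC mulfVK ?gt_eqF// ler_pdivlMr//.
apply: le_trans (cis_geometric s P).
by rewrite ler_wpM2l ?normc_ge0// cis_far.
Qed.

Section digit_blocks.
Variables (P Q K : nat).
Hypotheses (P_gt0 : (0 < P)%N) (Q_ge2 : (2 <= Q)%N) (K_gt0 : (0 < K)%N).

(** The number whose expansion in base [Q] repeats the block
xi (K-1), ..., xi 0 (when P <= Q, so that the xi i are genuine digits). *)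
Definition digit_sum (xi : {ffun 'I_K -> 'I_P}) : R :=
  \sum_(i < K) (xi i)%:R * (Q%:R ^+ i / (Q ^ K - 1)%:R).

Definition digit_shift (xi : {ffun 'I_K -> 'I_P}) : {ffun 'I_K -> 'I_P} :=
  [ffun i => xi (ord_pred i)].

Let M0 : 0 < (Q ^ K - 1)%:R :> R.
Proof.
rewrite ltr0n subn_gt0; apply: leq_trans Q_ge2 _.
by rewrite -[X in (X <= _)%N]expn1 leq_exp2l.
Qed.

Let ME : (Q ^ K - 1)%:R = Q%:R ^+ K - 1 :> R.
Proof. by rewrite natrB ?natrX// expn_gt0; lia. Qed.

Lemma digit_shift_inj : injective digit_shift.
Proof.
move=> x y /ffunP xy; apply/ffunP => i.
by have := xy (ordS i); rewrite !ffunE ordSK.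
Qed.

Lemma digit_sum_bound xi : 0 <= digit_sum xi <= 2 * P%:R / Q%:R.
Proof.
have Q2 : 2 <= Q%:R :> R by rewrite (ler_nat R 2).
apply/andP; split.
  by apply: sumr_ge0 => i _; rewrite mulr_ge0// divr_ge0// ltW.
apply: (@le_trans _ _ (\sum_(i < K) P%:R * (Q%:R ^+ i / (Q ^ K - 1)%:R))).
  apply: ler_sum => i _; rewrite ler_wpM2r ?divr_ge0// ?ler_nat ?ltW//.
  by rewrite -ltnS ltnW// ltnS.
rewrite -mulr_sumr -mulr_suml.
have := subrX1 (Q%:R : R) K; rewrite -ME => ->.
have S0 : \sum_(i < K) Q%:R ^+ i != 0 :> R.
  apply/negP => /eqP S0; have := M0; rewrite ME subrX1 S0 mulr0 ltxx//.
have -> : P%:R * ((\sum_(i < K) Q%:R ^+ i) / ((Q%:R - 1) * \sum_(i < K) Q%:R ^+ i)) =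
   P%:R / (Q%:R - 1) :> R.
  by field; rewrite S0 gt_eqF//; lra.
rewrite ler_pdivrMr; last lra.
rewrite mulrAC ler_pdivlMr; last lra.
by have : 0 <= P%:R :> R by []; nra.
Qed.

(** Multiplication by [Q] moves the leading digit in front of the point, and
it reappears at the other end of the block. *)
Lemma digit_sum_shift xi :
  circle_proj (digit_sum xi *+ Q) = circle_proj (digit_sum (digit_shift xi)).
Proof.
apply/circle_proj_eq; rewrite /digit_sum.
rewrite [X in _ - X](reindex_inj (@ordS_inj K))/=.
rewrite -[X in X - _]mulr_natl mulr_sumr -sumrB rpred_sum// => i _.
rewrite ffunE ordSK mulrCA -mulrBr rpredM ?rpred_nat//.
rewrite mulrA -exprS -mulrBl.
have iK := ltn_ord i; move: (iK); rewrite leq_eqVlt => /orP[/eqP iE|iK'].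
  by rewrite iE modnn expr0 -ME divff ?gt_eqF// rpred1.
by rewrite modn_small// subrr mul0r rpred0.
Qed.

Definition digit_fourier (t : R) : R :=
  normc (\sum_(xi : {ffun 'I_K -> 'I_P}) cis (t * digit_sum xi)) /
  #|{ffun 'I_K -> 'I_P}|%:R.

(** The digits are independent, so the Fourier transform of their sum is a
product of factors of modulus at most 1, any one of which bounds it. *)
Lemma digit_fourier_le (i : 'I_K) t :
  digit_fourier t <= digit_mean P (t * (Q%:R ^+ i / (Q ^ K - 1)%:R)).
Proof.
have P0 : 0 < P%:R :> R by rewrite ltr0n.
have card : #|{ffun 'I_K -> 'I_P}|%:R = P%:R ^+ K :> R.
  by rewrite card_ffun !card_ord natrX.
rewrite /digit_fourier card.
pose w (j : 'I_K) : R := t * (Q%:R ^+ j / (Q ^ K - 1)%:R).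
have -> : \sum_(xi : {ffun 'I_K -> 'I_P}) cis (t * digit_sum xi) =
    \prod_j \sum_(b < P) cis (b%:R * w j).
  rewrite bigA_distr_bigA; apply: eq_bigr => xi _.
  rewrite /digit_sum mulr_sumr.
  rewrite (big_morph (@cis R) (@cisD R) (@cis0 R)).
  by apply: eq_bigr => j _; rewrite /w mulrCA.
rewrite normc_prod.
have -> : P%:R ^+ K = \prod_(j < K) P%:R :> R by rewrite prodr_const card_ord.
rewrite -prodf_div (bigD1 i)//= -/(w i) -/(digit_mean P (w i)).
rewrite ler_piMr ?divr_ge0 ?normc_ge0//.
apply: prodr_ile1 => j _; rewrite divr_ge0 ?normc_ge0//=.
exact: digit_mean_le1.
Qed.

Lemma digit_fourier_le1 t : digit_fourier t <= 1.
Proof.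
apply: le_trans (digit_fourier_le (Ordinal K_gt0) t) _.
exact: digit_mean_le1.
Qed.

End digit_blocks.
End digits.

(** * Fourier coefficients along powers *)

Section powers.
Variable R : realType.

Lemma fejer_shift m (x y : R) : x - y \is a Num.int -> fejer m x = fejer m y.
Proof.
move=> xy; rewrite /fejer.
have -> // : \sum_(l < m) cis (l%:R * x) = \sum_(l < m) cis (l%:R * y).
apply: eq_bigr => l _; apply: cis_shift.
by rewrite -mulrBr rpredM ?rpred_nat.
Qed.

(** Apart from finitely many [n], the Fourier transform at t0 q^n can exceed
e / 2 only if the rescaled frequency s in [1, Q[ is within [d] of an integer;
by [near_int_detect] the proportion of such [n] is at most 4 * 96 d <= e / 2.
The number [P] of values of a digit depends on [e] only, since it has to be
chosen before the base [Q], while [A] may depend on the base. *)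
Lemma digit_fourier_power_sum (e : R) : 0 < e -> exists2 P, (0 < P)%N &
  forall (Q q : nat), (2 <= Q)%N -> (2 <= q)%N ->
  (forall d, (0 < d)%N -> d%:R * (ln q%:R / ln Q%:R) \isn't a @Num.int R) ->
  exists A : R, forall (N K t0 : nat), (0 < K)%N -> (0 < t0)%N ->
    (t0 * q ^ N < Q ^ K - 1)%N ->
    \sum_(n < N) digit_fourier P Q K ((t0 * q ^ n.+1)%:R : R) <= A + e * N%:R.
Proof.
move=> e0; pose d : R := Num.min 32^-1 (e / 8 / 96).
have d0 : 0 < d by rewrite lt_min invr_gt0 ltr0n divr_gt0 ?ltr0n // divr_gt0 // ltr0n.
have d32 : d <= 32^-1 by rewrite ge_min lexx.
have de : d <= e / 8 / 96 by rewrite ge_min lexx orbT.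
have d2 : d <= 2^-1 by lra.
have k0 := far_gap_gt0 d0 d2; set k := 1 - cos _ in k0.
pose P := (Num.truncn (4 / (k * e))).+1.
have P0 : 0 < P%:R :> R by rewrite ltr0n.
have Pe : 2 / (P%:R * k) <= e / 2.
  rewrite ler_pdivrMr ?mulr_gt0//.
  have : 4 / (k * e) < P%:R by exact: truncnS_gt.
  by rewrite ltr_pdivrMr ?mulr_gt0//; lra.
exists P => // Q q Q2 q2 irr; set al := ln q%:R / ln Q%:R in irr.
have Q2' : 2 <= Q%:R :> R by rewrite (ler_nat R 2).
set l := ln (Q%:R : R) in al irr; have l2 : 2^-1 <= l := ln_ge_half Q2'.
have l0 : 0 < l by lra.
have d032 : 0 < d <= 32^-1 by rewrite d0.
have [m [m0 summ near]] := near_int_detect Q2 d032.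
have [B Bge0 BP] : exists2 B : nat -> R, forall v, 0 <= B v & forall v N c,
    \sum_(n < N) fejer (m v) (n%:R * al + c) <= N%:R / (m v)%:R + B v.
  have [B BP] := choice (fun v => let: ex_intro2 b b0 bP := fejer_orbit (m0 v) irr in
    ex_intro (fun b => 0 <= b /\ forall N c,
      \sum_(n < N) fejer (m v) (n%:R * al + c) <= N%:R / (m v)%:R + b) b (conj b0 bP)).
  by exists B => v; have [] := BP v.
exists (Q%:R + 4 * \sum_(v < Q) B v) => N K t0 K0 t00 tK.
set M := (Q ^ K - 1)%N in tK *.
have M0 : 0 < M%:R :> R by rewrite ltr0n (leq_ltn_trans _ tK).
have q0 : (0 < q)%N by exact: leq_trans q2.
pose theta n : R := (t0 * q ^ n.+1)%:R / M%:R.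
have th0 n : 0 < theta n by rewrite divr_gt0// ltr0n muln_gt0 t00 expn_gt0 q0.
pose c0 := (ln (t0 * q)%:R - ln M%:R) / l.
have uE n : ln (theta n) / l = n%:R * al + c0.
  rewrite /theta ln_div ?posrE// ?ltr0n ?muln_gt0 ?t00 ?expn_gt0 ?q0//.
  rewrite expnS mulnA natrM lnM ?posrE ?ltr0n ?muln_gt0 ?t00 ?expn_gt0 ?q0//.
  rewrite natrX lnXn ?ltr0n//.
  by rewrite /c0 /al -mulr_natl; field; rewrite gt_eqF.
pose J n : R := \sum_(v < Q) fejer (m v) (n%:R * al + (c0 - ln v.+1%:R / l)).
have J0 n : 0 <= J n by apply: sumr_ge0 => v _; exact: fejer_ge0.
have main n : (n < N)%N -> digit_fourier P Q K ((t0 * q ^ n.+1)%:R : R) <=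
    (n < Q)%N%:R + 4 * J n + e / 2.
  move=> nN; have [nQ|Qn] := ltnP n Q.
    apply: le_trans (digit_fourier_le1 Q (ltn0Sn _) K0 _) _.
    by rewrite /=; have := J0 n; lra.
  rewrite add0r.
  (* The digit is the one of index [i = - z], as [theta n * Q ^ i] has
     logarithm u - z in base [Q].  The index is positive as [theta n < 1], and
     below [K] because the frequency is at least [Q]; the finitely many [n]
     for which it may be smaller are counted apart. *)
  set u := ln (theta n) / l; pose z := Num.floor u.
  have zu : z%:~R <= u by rewrite floor_le_tmp.
  have uz : u < z%:~R + 1 by have := floorD1_gt u; rewrite intrD.
  have big : Q%:R <= (t0 * q ^ n.+1)%:R :> R.
    rewrite ler_nat; apply: leq_trans (leq_pmull _ t00).
    by apply: (leq_trans Qn); apply: ltnW; apply: leq_trans (ltn_expl n q2) _;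
      rewrite leq_exp2l.
  have Q0 : 0 < Q%:R :> R by lra.
  have big0 : 0 < (t0 * q ^ n.+1)%:R :> R by exact: lt_le_trans big.
  have th1 : theta n < 1.
    rewrite ltr_pdivrMr// mul1r ltr_nat; apply: leq_ltn_trans tK.
    by rewrite leq_mul2l leq_exp2l ?nN ?orbT.
  have u0 : u < 0 by rewrite ltr_pdivrMr// mul0r ln_lt0// th0 th1.
  have z0 : (z < 0)%R by rewrite -(ltr_int R); exact: le_lt_trans u0.
  have zK : (- z < K%:Z)%R.
    rewrite -(ltr_int R) rmorphN/= ltrNl.
    suff : 1 - K%:R <= u by rewrite -[K%:~R]/(K%:R); lra.
    rewrite ler_pdivlMr// ln_div ?posrE//.
    have b1 : l <= ln (t0 * q ^ n.+1)%:R.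
      by rewrite ler_ln ?posrE.
    have b2 : ln (M%:R : R) <= K%:R * l.
      rewrite mulr_natl -lnXn// ler_ln ?posrE// ?exprn_gt0//.
      by rewrite -natrX ler_nat leq_subr.
    by lra.
  have [i iK zi] : exists2 i : nat, (i < K)%N & z = - i%:Z.
    by exists `|z|%N; move: z0 zK; clear; lia.
  pose s : R := (t0 * q ^ n.+1)%:R * (Q%:R ^+ i / M%:R).
  have sE : s = theta n * Q%:R ^+ i by rewrite /s /theta mulrA mulrAC.
  have s0 : 0 < s by rewrite sE mulr_gt0 ?exprn_gt0.
  have lns : ln s = l * (u + i%:R).
    rewrite sE lnM ?posrE ?exprn_gt0// lnXn// mulrDr /u.
    by rewrite mulrCA mulfV ?gt_eqF// mulr1 mulr_natr.
  have zR : z%:~R = - i%:R :> R by rewrite zi rmorphN.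
  have s1Q : 1 <= s < Q%:R.
    apply/andP; split.
      rewrite -ler_ln ?posrE// ln1 lns mulr_ge0 ?(ltW l0)//.
      by rewrite zR in zu; lra.
    rewrite -ltr_ln ?posrE// lns -/l -[ltRHS]mulr1 ltr_pM2l//.
    by rewrite zR in uz; lra.
  apply: le_trans (digit_fourier_le Q (ltn0Sn _) (Ordinal iK) _) _.
  rewrite -/M -/s.
  have [[j sj]|far] := pselect (exists j : int, `|s - j%:~R| < d).
    have := near s s1Q (ex_intro _ j sj).
    have -> : \sum_(v < Q) fejer (m v) (ln s / ln Q%:R - ln (v.+1%:R : R) / ln Q%:R) = J n.
      apply: eq_bigr => v _; apply: fejer_shift; rewrite -/l lns.
      have -> : l * (u + i%:R) / l = u + i%:R by field; rewrite gt_eqF.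
      rewrite /u uE; set x := _ / l.
      have -> : n%:R * al + c0 + i%:R - x - (n%:R * al + (c0 - x)) = i%:R by ring.
      exact: rpred_nat.
    by have := digit_mean_le1 P s; lra.
  have fars j : d <= `|s - j%:~R|.
    by rewrite leNgt; apply/negP => sj; apply: far; exists j.
  have := @digit_mean_far R P s d (ltn0Sn _) d0 d2 fars; rewrite -/k.
  by have := J0 n; lra.
apply: (@le_trans _ _ (\sum_(n < N) ((n < Q)%N%:R + 4 * J n + e / 2))).
  by apply: ler_sum => n _; exact: main.
rewrite !big_split/= sumr_const card_ord -mulr_sumr exchange_big/=.
have h1 : \sum_(n < N) (n < Q)%N%:R <= Q%:R :> R.
  rewrite -natr_sum ler_nat.
  have H j : (\sum_(n < j) (n < Q) <= minn j Q)%N.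
    elim: j => [|j IHj]; first by rewrite big_ord0.
    rewrite big_ord_recr/=; move: IHj; set S := (\sum_(n < j) _)%N; clearbody S.
    by clear; case: ltnP => /= ? ?; lia.
  by apply: leq_trans (H N) _; rewrite geq_minr.
have h2 : \sum_(v < Q) \sum_(n < N) fejer (m v) (n%:R * al + (c0 - ln v.+1%:R / l)) <=
    N%:R * (96 * d) + \sum_(v < Q) B v.
  apply: (@le_trans _ _ (\sum_(v < Q) (N%:R * (m v)%:R^-1 + B v))).
    by apply: ler_sum => v _; exact: BP.
  by rewrite big_split/= -mulr_sumr lerD2r ler_wpM2l.
have N0 : 0 <= N%:R :> R by [].
rewrite -mulr_natl; have : N%:R * (96 * d) <= N%:R * (e / 8).
  by rewrite ler_wpM2l//; lra.
by lra.
Qed.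

End powers.

(** * Invariant measures on grids *)

(** Take m = 1 + p + ... + p^(L-1) with L - 1 a multiple of q!.  A prime
divisor r of q that divides p does not divide m, as m = 1 mod p.  Otherwise r
divides S = 1 + p + ... + p^(L-2), by Fermat if p is not 1 mod r, since r - 1
divides L - 1, and because S = L - 1 mod r if p = 1 mod r; hence
m = 1 + p S = 1 mod r. *)
Lemma exists_grid (p q L0 : nat) : (2 <= p)%N -> (2 <= q)%N ->
  exists L m, [/\ (L0 <= L)%N, (0 < L)%N & (0 < m)%N] /\
    [/\ (m %| p ^ L - 1)%N, (p ^ L <= p * m)%N & coprime m q].
Proof.
move=> p2 q2; have p0 : (0 < p)%N by exact: leq_trans p2.
pose S n := (\sum_(i < n) p ^ i)%N.
have SE n : (p ^ n - 1 = (p - 1) * S n)%N by rewrite !subn1 predn_exp.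
have SS n : (S n.+1 = 1 + p * S n)%N.
  rewrite /S big_ord_recl/= expn0 big_distrr/=; congr (_ + _)%N.
  by apply: eq_bigr => i _; rewrite -expnS.
pose L := (L0 * q`!).+1; exists L, (S L); split; split => //.
- by rewrite ltnW// ltnS leq_pmulr// fact_gt0.
- by rewrite SS.
- by rewrite SE dvdn_mull.
- by rewrite expnS leq_mul2l /S big_ord_recr/= leq_addl orbT.
rewrite coprime_sym; apply/negPn/negP => nc.
have [r [rp rq rS]] : exists r, [/\ prime r, (r %| q)%N & (r %| S L)%N].
  have := pdiv_dvd (gcdn q (S L)); rewrite dvdn_gcd => /andP[rq rS].
  exists (pdiv (gcdn q (S L))); split=> //.
  apply: pdiv_prime; rewrite ltn_neqAle eq_sym nc/= gcdn_gt0.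
  by rewrite (leq_trans _ q2).
have rle : (r <= q)%N by apply: dvdn_leq => //; exact: leq_trans q2.
have r0 : (0 < r)%N := prime_gt0 rp.
have r1 : (1 < r)%N := prime_gt1 rp.
have [rdp|rndp] := boolP (r %| p)%N.
  have : (r %| 1)%N by move: rS; rewrite SS dvdn_addl ?dvdn_mulr.
  by rewrite dvdn1; apply/negP; rewrite gtn_eqF.
have rSn : (r %| S (L0 * q`!))%N.
  have [rp1|rnp1] := boolP (r %| p - 1)%N.
    have H n : (S n = n %[mod r])%N.
      elim: n => [|n IHn]; first by rewrite /S big_ord0.
      have p1 : (p = 1 %[mod r])%N by apply/eqP; rewrite eqn_mod_dvd.
      by rewrite SS -modnDmr -modnMm p1 IHn modnMm mul1n modnDmr.
    have : (S (L0 * q`!) = 0 %[mod r])%N.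
      by rewrite H mod0n; apply/eqP; rewrite -/(dvdn _ _) dvdn_mull// dvdn_fact// r0.
    by move=> /eqP; rewrite mod0n.
  have : (r %| (p - 1) * S (L0 * q`!))%N.
    rewrite -SE; have co : coprime p r by rewrite coprime_sym prime_coprime.
    have [t tE] : exists t, (L0 * q`! = t * r.-1)%N.
      apply/dvdnP; apply: dvdn_mull; apply: dvdn_fact.
      by rewrite (leq_trans (leq_pred r))// andbT; move: r1; clear; lia.
    rewrite tE mulnC expnM -totient_prime// -eqn_mod_dvd ?expn_gt0 ?p0//.
    by rewrite -modnXm cyclic.Euler_exp_totient// modnXm exp1n.
  by rewrite Euclid_dvdM// (negPf rnp1).
have : (r %| 1)%N by move: rS; rewrite SS dvdn_addl ?dvdn_mull.
by rewrite dvdn1; apply/negP; rewrite gtn_eqF.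
Qed.

Section dense_invariant.
Variables (R : realType) (p : nat).
Hypothesis p_ge2 : (2 <= p)%N.

(** The constant [C] may depend on [nu], but not on [L], for the perturbed
measures to come close to [nu]. *)
Lemma shadow_dense (A : set (circle_prob R)) :
  (forall nu, invariant_prob R p nu -> exists2 C : R, 0 <= C &
    forall L0, exists L mu, [/\ (L0 <= L)%N, invariant_prob R p mu,
      shadow p C L nu mu & A mu]) ->
  dense [set mu : invariant_prob R p | A (val mu)].
Proof.
move=> HA U [nu Unu] [B oB BU].
have nuI : invariant_prob R p (val nu) := set_valP nu.
have [C C0 CP] := HA _ nuI.
have Bnu : B (val nu) by rewrite -BU in Unu.
have [L0 LP] := shadow_nbhs p_ge2 C0 (open_nbhs_nbhs (conj oB Bnu)).
have [L [mu [L0L muI sh Amu]]] := CP L0.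
exists (SigSub (mem_set muI)); split=> //.
by rewrite -BU; exact: (LP L L0L).
Qed.

End dense_invariant.

Section grid_fourier.
Variables (R : realType) (p L m : nat) (Xi : finType) (xi0 : Xi) (Y : Xi -> R).
Local Notation normc := (@ComplexField.Normc.normc R).
Hypotheses (L_gt0 : (0 < L)%N).

Definition offset_fourier (t : R) : R :=
  normc (\sum_xi cis (t * Y xi)) / #|Xi|%:R.

Variables (nu mu : circle_prob R).
Hypothesis muE : forall f, bounded_mfun f -> \int[mu]_c f c =
  (L * #|Xi|)%:R^-1 *
    \sum_(j < L) \sum_xi \int[nu]_c f (grid_image m Y (p ^ j) xi c).
Hypothesis measurable_image : forall n xi, measurable_fun setT (grid_image m Y n xi).

Let Xi_gt0 : 0 < #|Xi|%:R :> R.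
Proof. by rewrite ltr0n; apply/card_gt0P; exists xi0. Qed.

(** Given the point of the grid, the mean over the offsets of an exponential
is a phase times the Fourier transform of the offset, so the bound holds before
integrating against [nu].  The function [F] is the real or the imaginary part. *)
Lemma grid_mean_bound (f : circle R -> R) (F : R[i] -> R) (t : nat) :
  (forall z, `|F z| <= normc z) ->
  (forall (I : finType) (G : I -> R[i]), F (\sum_i G i) = \sum_i F (G i)) ->
  (forall x, f (circle_proj x) = F (cis (t%:R * x))) -> bounded_mfun f ->
  `|\int[mu]_c f c| <= L%:R^-1 * \sum_(j < L) offset_fourier (t * p ^ j)%:R.
Proof.
move=> Fle Fsum fF bf; rewrite muE// natrM invfM -mulrA normrM ger0_norm//.
have L0 : 0 < L%:R :> R by rewrite ltr0n.
rewrite ler_wpM2l// normrM ger0_norm ?invr_ge0//.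
rewrite ler_pdivrMl// mulr_sumr (le_trans (ler_norm_sum _ _ _))//.
apply: ler_sum => j _; rewrite /offset_fourier mulrCA mulfV ?gt_eqF// mulr1.
have bi xi : bounded_mfun (fun c => f (grid_image m Y (p ^ j) xi c)).
  exact: (bounded_mfun_comp (measurable_image (p ^ j) xi) bf).
rewrite -(mean_sum nu (index_enum Xi) bi).
apply: norm_mean_le; first exact: bounded_mfun_sum.
move=> c; set g := grid_point m (circle_lift c).
have -> : \sum_xi f (grid_image m Y (p ^ j) xi c) =
    F (cis ((t * p ^ j)%:R * g) * \sum_xi cis ((t * p ^ j)%:R * Y xi)).
  rewrite mulr_sumr Fsum; apply: eq_bigr => xi _.
  by rewrite grid_image_proj fF -cisD mulrA -natrM -mulrDr.
by rewrite (le_trans (Fle _))// ComplexField.Normc.normcM normc_cis mul1r.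
Qed.

Lemma grid_fourier_cos t : `|fourier_cos t mu| <=
  L%:R^-1 * \sum_(j < L) offset_fourier (t * p ^ j)%:R.
Proof.
apply: (@grid_mean_bound _ (@complex.Re R)).
- exact: le_Re_normc.
- by move=> I G; exact: Re_sum.
- by move=> x; rewrite circle_cos_proj.
- exact: bounded_circle_cos.
Qed.

Lemma grid_fourier_sin t : `|fourier_sin t mu| <=
  L%:R^-1 * \sum_(j < L) offset_fourier (t * p ^ j)%:R.
Proof.
apply: (@grid_mean_bound _ (@complex.Im R)).
- exact: le_Im_normc.
- by move=> I G; exact: Im_sum.
- by move=> x; rewrite circle_sin_proj.
- exact: bounded_circle_sin.
Qed.

End grid_fourier.

(** * The three generic properties *)

Section generic.
Variables (R : realType) (q : nat).
Implicit Types mu nu : circle_prob R.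

Definition not_Lebesgue : set (circle_prob R) :=
  [set mu | exists2 a, (0 < a)%N & fourier_cos a mu != 0].

Definition recurrent (k : nat) : set (circle_prob R) :=
  [set mu | exists2 n, (k <= n)%N & forall a : 'I_k.+1,
    `|fourier_cos (a * q ^ n) mu - fourier_cos a mu| < k.+1%:R^-1].

Definition equidistributed_at (k n : nat) : set (circle_prob R) :=
  [set mu | forall a : 'I_k,
    `|fourier_cos (a.+1 * q ^ n) mu| < k.+1%:R^-1 /\
    `|fourier_sin (a.+1 * q ^ n) mu| < k.+1%:R^-1].

Definition equidistributed (k : nat) : set (circle_prob R) :=
  [set mu | exists2 N, (k < N)%N & (1 - k.+1%:R^-1) * N%:R <
    ((count (fun n => mu \in equidistributed_at k n) (index_iota 1 N.+1))%:R : R)].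

Lemma fourier_small_push k n mu :
  fourier_small k (circle_push (q ^ n) mu) <-> equidistributed_at k n mu.
Proof.
split=> [small a|small a /andP[a0 ak]].
  have [|] := small a.+1; first by rewrite ltn_ord.
  by rewrite fourier_cos_push fourier_sin_push.
have a1k : (a.-1 < k)%N by rewrite prednK.
have := small (Ordinal a1k); rewrite /= prednK//.
by rewrite fourier_cos_push fourier_sin_push.
Qed.

Let cvg_cos a mu : fourier_cos a nu @[nu --> mu] --> fourier_cos a mu.
Proof. exact: (continuous_mean (@continuous_circle_cos R a)). Qed.

Let cvg_sin a mu : fourier_sin a nu @[nu --> mu] --> fourier_sin a mu.
Proof. exact: (continuous_mean (@continuous_circle_sin R a)). Qed.

Let near_lt (f : circle_prob R -> R) mu e :
  f nu @[nu --> mu] --> f mu -> `|f mu| < e -> \forall nu \near mu, `|f nu| < e.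
Proof. by move=> fmu fe; exact: (cvgr_norm_lt _ fmu _ fe). Qed.

Lemma open_not_Lebesgue : open not_Lebesgue.
Proof.
rewrite openE => mu [a a0 Ca]; apply: filterS (cvgr_neq0 _ (@cvg_cos a mu) Ca).
by move=> nu Cnu; exists a.
Qed.

Lemma open_recurrent k : open (recurrent k).
Proof.
rewrite openE => mu [n kn small]; suff : \forall nu \near mu, forall a : 'I_k.+1,
    `|fourier_cos (a * q ^ n) nu - fourier_cos a nu| < k.+1%:R^-1.
  by apply: filterS => nu H; exists n.
apply: (@filter_forall _ _ _ _ (nbhs_filter mu)) => a.
apply: (near_lt (f := fun nu => fourier_cos (a * q ^ n) nu - fourier_cos a nu)).
  by apply: cvgB; [exact: nbhs_filter|exact: cvg_cos|exact: cvg_cos].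
exact: small.
Qed.

Lemma open_equidistributed_at k n : open (equidistributed_at k n).
Proof.
rewrite openE => mu small; apply: (@filter_forall _ _ _ _ (nbhs_filter mu)) => a.
have [ca sa] := small a.
apply: (@filterI _ _ (nbhs_filter mu)).
  by apply: (near_lt (f := fun nu => fourier_cos (a.+1 * q ^ n) nu)) => //; exact: cvg_cos.
by apply: (near_lt (f := fun nu => fourier_sin (a.+1 * q ^ n) nu)) => //; exact: cvg_sin.
Qed.

Lemma open_equidistributed k : open (equidistributed k).
Proof.
rewrite openE => mu [N kN cnt].
suff : \forall nu \near mu, forall n : 'I_N.+1,
    equidistributed_at k n mu -> equidistributed_at k n nu.
  apply: filterS => nu H; exists N => //; apply: (lt_le_trans cnt).
  rewrite ler_nat -!sum1_count big_mkcond [leqRHS]big_mkcond/= big_nat [leqRHS]big_nat.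
  apply: leq_sum => n /andP[_ nN]; case: ifPn => // /set_mem En.
  by rewrite mem_set//; exact: (H (Ordinal nN)).
apply: (@filter_forall _ _ _ _ (nbhs_filter mu)) => n; have [En|nEn] := pselect (equidistributed_at k n mu).
  apply: filterS (open_nbhs_nbhs (conj (@open_equidistributed_at k n) En)).
  by move=> nu.
by apply: nearW => nu.
Qed.

(** Given a neighbourhood of Lebesgue measure, the proportions
in the limsup exceed 1 - 1/(k+1) at some N > k, for every large k. *)
Lemma equidistributed_upper_density mu :
  (forall k, equidistributed k mu) ->
  cvg_upper_density1 R (fun n => circle_push (q ^ n) mu) (Leb R).
Proof.
move=> eq V /fourier_small_nbhs[k0 k0V].
set u : nat -> \bar R := fun N => _.
have u_le1 N : (u N <= 1)%E.
  rewrite /u lee_fin; have [->|N0] := posnP N; first by rewrite invr0 mulr0 ler01.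
  rewrite ler_pdivrMr ?ltr0n// mul1r ler_nat (leq_trans (count_size _ _))//.
  by rewrite size_iota subn1.
have esup1 n : esups u n = 1%E.
  apply/eqP; rewrite eq_le; apply/andP; split.
    by apply: ge_ereal_sup => _ [N _ <-].
  apply/lee_addgt0Pr => e e0; rewrite -leeBlDr//.
  pose k := maxn (maxn k0 n) (Num.truncn e^-1).
  have [N kN cnt] := eq k.
  have N0 : 0 < N%:R :> R by rewrite ltr0n (leq_trans _ kN).
  have ke : k.+1%:R^-1 <= e.
    rewrite -[leRHS]invrK lef_pV2 ?posrE ?invr_gt0//.
    by rewrite ltW// (lt_le_trans (truncnS_gt _))// ler_nat ltnS leq_maxr.
  apply: (@le_trans _ _ (u N)); last first.
    apply: ereal_sup_ubound; exists N => //=.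
    by rewrite (leq_trans _ (ltnW kN))// /k -maxnA maxnCA leq_maxl.
  rewrite /u -EFinB lee_fin ler_pdivlMr//.
  apply: (@le_trans _ _ ((1 - k.+1%:R^-1) * N%:R)).
    by rewrite ler_wpM2r// lerB.
  apply: (le_trans (ltW cnt)); rewrite ler_nat; apply: sub_count => m.
  rewrite !inE => /fourier_small_push small; apply: k0V.
  by apply: fourier_small_mono small; rewrite /k -maxnA leq_maxl.
rewrite limn_esup_lim (funext esup1); apply: cvg_lim => //.
exact: cvg_cst.
Qed.

(** If x is an atom of [mu], then T_{q^n} x has at least the same mass for
T_{q^n} mu; but for some n the coefficients of T_{q^n} mu are small. *)
Lemma equidistributed_atomless mu :
  (forall k, equidistributed k mu) -> atomless mu.
Proof.
move=> eq x; have fin (nu : circle_prob R) A : measurable A -> nu A \is a fin_num.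
  by move=> mA; rewrite fin_num_measure.
have m1 := @measurable_circle1 R.
rewrite -(fineK (fin mu _ (m1 x))); congr (_%:E); apply/eqP.
rewrite eq_le fine_ge0// andbT; apply/ler_addgt0Pr => e e0; rewrite add0r.
(* A measure with small coefficients up to order [k] has atoms of mass at most
   3 / (k + 1). *)
pose k := Num.truncn (3 / e).
have ke : 3 * k.+1%:R^-1 <= e.
  rewrite ler_pdivrMr// mulrC -ler_pdivrMr// ltW//.
  exact: truncnS_gt.
apply: le_trans ke; have [N kN cnt] := eq k.
have [n smalln] : exists n, equidistributed_at k n mu.
  apply: contrapT => none.
  move: cnt; rewrite (@eq_count _ _ pred0) ?count_pred0; last first.
    by move=> n /=; apply/negP; rewrite inE => En; apply: none; exists n.
  apply/negP; rewrite -leNgt mulr_ge0// subr_ge0 invf_le1 ?ltr0n// ler1n//.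
have small : fourier_small k (circle_push (q ^ n) mu) by exact/fourier_small_push.
apply: le_trans (fourier_small_atom (circle_times (q ^ n) x) small).
rewrite fine_le ?fin//.
apply: le_measure; rewrite ?inE//.
- rewrite -[X in measurable X]setTI.
  by apply: circle_times_measurable.
- by move=> _ ->.
Qed.

(** Convergence to Lebesgue measure makes C_{a q^n} tend to 0, whereas by
recurrence C_{a q^n} comes arbitrarily close to C_a for arbitrarily large n. *)
Lemma not_cvg_Lebesgue mu : not_Lebesgue mu -> (forall k, recurrent k mu) ->
  ~ (circle_push (q ^ n) mu @[n --> \oo] --> Leb R).
Proof.
move=> [a a0 Ca] rec cv; move/negP : Ca; apply; rewrite -normr_le0.
apply/ler_addgt0Pr => e e0; rewrite add0r.
have : fourier_cos (a * q ^ n) mu @[n --> \oo] --> (0 : R).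
  rewrite -(fourier_cos_Leb R a0).
  have := cvg_comp _ _ cv (@cvg_cos a (Leb R)).
  by rewrite /comp; under eq_fun do rewrite fourier_cos_push.
move=> /cvgrPdist_le/(_ (e / 2) (divr_gt0 e0 (ltr0Sn R 1)))[n0 _ n0P].
pose k := maxn (maxn n0 a) (Num.truncn (2 / e)).
have [n kn recn] := rec k.
have ak : (a < k.+1)%N by rewrite ltnS /k -maxnA maxnCA leq_maxl.
have n0n : (n0 <= n)%N by rewrite (leq_trans _ kn)// /k -maxnA leq_maxl.
have := recn (Ordinal ak); rewrite /= => h1.
have h2 : `|0 - fourier_cos (a * q ^ n) mu| <= e / 2 := n0P n n0n.
have ke : k.+1%:R^-1 <= e / 2.
  rewrite -[leRHS]invrK lef_pV2 ?posrE ?invr_gt0 ?divr_gt0// invf_div.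
  by rewrite ltW// (lt_le_trans (truncnS_gt _))// ler_nat ltnS leq_maxr.
have {h1 ke} h1 := le_trans (ltW h1) ke.
move: h1 h2; rewrite !ler_norml => /andP[? ?] /andP[? ?].
by apply/andP; split; lra.
Qed.

End generic.

(** * Density of the generic properties *)

Section density.
Variables (R : realType) (p q : nat).
Hypotheses (p_ge2 : (2 <= p)%N) (q_ge2 : (2 <= q)%N).

Let p_gt0 : (0 < p)%N := ltnW p_ge2.
Let q_gt0 : (0 < q)%N := ltnW q_ge2.

(** With zero offsets, the measure of [grid_measure] is carried by the
multiples of 1/m.  The cosine of frequency m is 1 there, and T_{q^n} fixes all
of them if n is a multiple of phi(m), by Euler. *)
Lemma exists_rational_measure (nu : circle_prob R) (L0 : nat) :
  invariant_prob R p nu -> exists L mu, [/\ (L0 <= L)%N, invariant_prob R p mu,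
    shadow p 0 L nu mu & not_Lebesgue mu /\ forall k, recurrent q k mu].
Proof.
move=> nuI.
have [L [m [[L0L L_gt0 m_gt0] [pLm m_large mq]]]] := exists_grid L0 p_ge2 q_ge2.
pose Y (_ : unit) : R := 0.
have Yb xi : 0 <= Y xi <= 0 / p%:R ^+ L by rewrite mul0r lexx.
have Ys xi : circle_proj (Y xi *+ p ^ L) = circle_proj (Y (id xi)).
  by rewrite /Y mul0rn.
have [mu [muI sh muE]] := grid_measure p_ge2 L_gt0 m_gt0 pLm m_large tt
  (@inj_id unit) Yb Ys nuI.
exists L, mu; split=> //; split.
  exists m => //; rewrite /fourier_cos muE; last exact: bounded_circle_cos.
  have -> : \sum_(j < L) \sum_(xi : unit)
      \int[nu]_c circle_cos m (grid_image m Y (p ^ j) xi c) = L%:R.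
    rewrite -[RHS]mulr1 mulr_natl -[X in _ *+ X]card_ord -sumr_const.
    apply: eq_bigr => j _; rewrite (bigD1 tt)//= big1 ?addr0; last by case.
    rewrite -[RHS](mean_cst nu); apply: eq_Rintegral => c _.
    rewrite grid_image_proj circle_cos_proj /Y addr0 [m%:R * _]mulrA -natrM.
    have gi := @grid_int R m m_gt0 (m * p ^ j) c (dvdn_mulr _ (dvdnn m)).
    by have [-> _] := cis_int gi.
  by rewrite card_unit muln1 mulVf ?oner_neq0// pnatr_eq0 -lt0n.
move=> k; pose n := (k.+1 * totient m)%N.
have qn : (m %| q ^ n - 1)%N.
  rewrite -eqn_mod_dvd ?expn_gt0 ?q_gt0// /n mulnC expnM.
  by rewrite -modnXm cyclic.Euler_exp_totient 1?coprime_sym// modnXm exp1n.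
exists n.
  by rewrite (leq_trans (leqnSn k))// leq_pmulr// totient_gt0.
move=> a.
suff -> : fourier_cos (a * q ^ n) mu = fourier_cos a mu by rewrite subrr normr0 invr_gt0.
rewrite -fourier_cos_push /fourier_cos mean_push; last exact: continuous_circle_cos.
rewrite !muE; last 2 first.
- exact: bounded_circle_cos.
- exact/continuous_circle_bounded_mfun/continuous_comp_times/continuous_circle_cos.
congr (_ * _); apply: eq_bigr => j _; apply: eq_bigr => xi _.
apply: eq_Rintegral => c _; congr circle_cos.
rewrite grid_image_times mulnC /grid_image /circle_times mulrnA.
have -> : circle_proj (Y xi) = 0 by rewrite /Y circle_proj_int// rpred0.
have qn0 : (0 < q ^ n)%N by rewrite expn_gt0 q_gt0.
by rewrite addr0 (grid_fixed m_gt0 c qn0 qn).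
Qed.

Hypothesis pq : mult_independent R p q.

(** A relation d ln q / (L ln p) = z, with integers d, L, z > 0, makes
ln p / ln q rational. *)
Lemma rotation_irrational L d : (0 < L)%N -> (0 < d)%N ->
  d%:R * (ln q%:R / ln (p ^ L)%:R) \isn't a @Num.int R.
Proof.
move=> L0 d0; apply/negP => /intrP[z zE].
have lq : 0 < ln (q%:R : R) by rewrite ln_gt0// ltr1n.
have lp : 0 < ln (p%:R : R) by rewrite ln_gt0// ltr1n.
have L0' : 0 < L%:R :> R by rewrite ltr0n.
have d0' : 0 < d%:R :> R by rewrite ltr0n.
have lpL : ln (p ^ L)%:R = L%:R * ln p%:R :> R.
  by rewrite natrX lnXn ?ltr0n// mulr_natl.
rewrite lpL in zE.
have z0 : 0 < (z%:~R : R) by rewrite -zE mulr_gt0// divr_gt0// mulr_gt0.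
case: z z0 zE => [z|z]; last first.
  by rewrite ltr0z.
rewrite ltr0z => z0 zE; apply: pq; apply/rationalP; exists d, (z * L)%N.
have zE' : d%:R * (ln q%:R / (L%:R * ln p%:R)) = z%:R :> R by exact: zE.
rewrite -[d%:~R]/(d%:R) natrM -zE'.
by field; rewrite !gt_eqF.
Qed.

(** By [digit_fourier_power_sum], applied to the frequencies
a p^j q^n for a <= k and j < L, the coefficients at a q^n of the measure with
digit offsets are small on average over n <= N.  Markov's inequality turns this
into smallness for all but a few n. *)
Lemma exists_equidistributed_measure (nu : circle_prob R) (k : nat) :
  invariant_prob R p nu -> exists2 C : R, 0 <= C & forall L0, exists L mu,
    [/\ (L0 <= L)%N, invariant_prob R p mu, shadow p C L nu mu &
        equidistributed q k mu].
Proof.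
move=> nuI; have k0 : 0 < k.+1%:R :> R by rewrite ltr0n.
(* The [k] frequencies contribute 2 e N each, and an [n] is bad if the sum of
   their bounds is at least 1/(k+1).  So the proportion of bad [n] is at most
   2 k (k+1) e, which has to be less than 1/(k+1). *)
pose e : R := (4 * k.+1%:R ^+ 3)^-1.
have e0 : 0 < e by rewrite invr_gt0 mulr_gt0// exprn_gt0.
have [P P_gt0 PP] := digit_fourier_power_sum e0.
exists (2 * P%:R) => [|L0]; first by rewrite mulr_ge0.
have [L [m [[L0L L_gt0 m_gt0] [pLm m_large _]]]] := exists_grid L0 p_ge2 q_ge2.
have Q2 : (2 <= p ^ L)%N.
  by rewrite (leq_trans p_ge2)// -[X in (X <= _)%N]expn1 leq_pexp2l.
have [A AP] := PP _ _ Q2 q_ge2 (fun d => @rotation_irrational L d L_gt0).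
pose N := (maxn k (Num.truncn (A / e))).+1.
have AN : A <= e * N%:R.
  rewrite mulrC -ler_pdivrMr// ltW// (lt_le_trans (truncnS_gt _))//.
  by rewrite ler_nat ltnS leq_maxr.
(* All the frequencies that occur must be less than [Q ^ K - 1]. *)
pose K := (k * p ^ L * q ^ N).+2.
have K_gt0 : (0 < K)%N by [].
have card_gt : (0 < #|{ffun 'I_K -> 'I_P}|)%N.
  by rewrite card_ffun !card_ord expn_gt0 P_gt0.
have [xi0 _] : exists xi0 : {ffun 'I_K -> 'I_P}, true.
  by move/card_gt0P : card_gt => [x _]; exists x.
have Yb (xi : {ffun 'I_K -> 'I_P}) :
    0 <= digit_sum R (p ^ L) xi <= 2 * P%:R / p%:R ^+ L.
  by have := @digit_sum_bound R P (p ^ L) K P_gt0 Q2 K_gt0 xi; rewrite natrX.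
have [mu [muI sh muE]] := grid_measure p_ge2 L_gt0 m_gt0 pLm m_large xi0
  (@digit_shift_inj P K) Yb (digit_sum_shift R P_gt0 Q2 K_gt0) nuI.
exists L, mu; split=> //; exists N; first by rewrite ltnS leq_maxl.
have mi := @measurable_grid_image R m m_gt0 _ (@digit_sum R P (p ^ L) K).
pose W a n : R := L%:R^-1 *
  \sum_(j < L) offset_fourier (@digit_sum R P (p ^ L) K)
    ((a * q ^ n) * p ^ j)%:R.
have Wcos a n : `|fourier_cos (a * q ^ n) mu| <= W a n.
  exact: (grid_fourier_cos xi0 L_gt0 muE mi).
have Wsin a n : `|fourier_sin (a * q ^ n) mu| <= W a n.
  exact: (grid_fourier_sin xi0 L_gt0 muE mi).
have W0 a n : 0 <= W a n by exact: le_trans (Wcos a n).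
have L0' : 0 < L%:R :> R by rewrite ltr0n.
have N0' : 0 < N%:R :> R by rewrite ltr0n.
have Wsum (a : 'I_k) : \sum_(n < N) W a.+1 n.+1 <= 2 * e * N%:R.
  rewrite -mulr_sumr exchange_big/= ler_pdivrMl//.
  have -> : L%:R * (2 * e * N%:R) = \sum_(j < L) 2 * e * N%:R.
    by rewrite sumr_const card_ord mulr_natl.
  apply: ler_sum => j _.
  have -> : \sum_(n < N) offset_fourier (@digit_sum R P (p ^ L) K)
      (a.+1 * q ^ n.+1 * p ^ j)%:R =
      \sum_(n < N) digit_fourier P (p ^ L) K ((a.+1 * p ^ j * q ^ n.+1)%:R : R).
    by apply: eq_bigr => n _; rewrite mulnAC.
  apply: (@le_trans _ _ (A + e * N%:R)); last by lra.
  apply: AP => //; first by rewrite muln_gt0 expn_gt0 p_gt0.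
  have : (a.+1 * p ^ j * q ^ N <= k * p ^ L * q ^ N)%N.
    apply: leq_mul => //; apply: leq_mul; first exact: ltn_ord.
    by rewrite leq_pexp2l// ltnW.
  have : (K < (p ^ L) ^ K)%N by exact: ltn_expl.
  by rewrite /K; clear; set x := (k * _ * _)%N; set y := (_ * _ * _)%N; set z := (_ ^ _)%N; lia.
pose good n := mu \in equidistributed_at q k n.
have bad n : 1 - (good n)%:R <= k.+1%:R * \sum_(a < k) W a.+1 n.
  have S0 : 0 <= \sum_(a < k) W a.+1 n by apply: sumr_ge0.
  case: (boolP (good n)) => [_|]; first by rewrite subrr mulr_ge0.
  rewrite notin_setE => nE; rewrite subr0 -ler_pdivrMl// mulr1.
  apply: contrapT => /negP; rewrite -ltNge => lt; apply: nE => a.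
  have Wa : W a.+1 n < k.+1%:R^-1.
    apply: le_lt_trans lt; rewrite (bigD1 a)//= lerDl.
    by apply: sumr_ge0.
  by split; [exact: le_lt_trans (Wcos _ _) Wa|exact: le_lt_trans (Wsin _ _) Wa].
have cntE : (count good (index_iota 1 N.+1))%:R = \sum_(n < N) (good n.+1)%:R :> R.
  rewrite -sum1_count big_mkcond/= big_add1/= big_mkord natr_sum.
  by apply: eq_bigr => n _; case: (good n.+1).
rewrite cntE; have : \sum_(n < N) (1 - (good n.+1)%:R) <= k.+1%:R * (k%:R * (2 * e * N%:R)).
  apply: (@le_trans _ _ (\sum_(n < N) k.+1%:R * \sum_(a < k) W a.+1 n.+1)).
    by apply: ler_sum => n _; exact: bad.
  rewrite -mulr_sumr exchange_big/= ler_pM2l//.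
  have -> : k%:R * (2 * e * N%:R) = \sum_(a < k) 2 * e * N%:R.
    by rewrite sumr_const card_ord mulr_natl.
  by apply: ler_sum => a _; exact: Wsum.
rewrite sumrB sumr_const card_ord.
set S := \sum_(n < N) _ => h.
have : k.+1%:R * (k%:R * (2 * e * N%:R)) < k.+1%:R^-1 * N%:R.
  rewrite !mulrA ltr_pM2r//.
  have kk : k%:R < k.+1%:R :> R by rewrite ltr_nat.
  have -> : k.+1%:R * k%:R * 2 * e = k.+1%:R^-1 * (k%:R * (2 * k.+1%:R)^-1).
    by rewrite /e; field; rewrite gt_eqF.
  rewrite gtr_pMr ?invr_gt0// ltr_pdivrMr ?mulr_gt0// mul1r; lra.
move: h; rewrite mulrBl mul1r; set T := _^-1 * _; set U := _ * (_ * _).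
by clear; lra.
Qed.

End density.

Unset Implicit Arguments.

Theorem corollary1p6 (R : realType) (p q : nat) :
  (2 <= p)%N -> (2 <= q)%N -> mult_independent R p q ->
  residual [set mu : invariant_prob R p |
    [/\ atomless (val mu),
        ~ (circle_push (q ^ n) (val mu) @[n --> \oo] --> Leb R) &
        cvg_upper_density1 R (fun n => circle_push (q ^ n) (val mu)) (Leb R)]].
Proof.
move=> p2 q2 pq.
(* After the first condition, the conditions [recurrent] and [equidistributed]
   alternate. *)
pose P (n : nat) : set (circle_prob R) := if n is n'.+1 then
  if odd n' then equidistributed q n'./2 else recurrent q n'./2
  else @not_Lebesgue R.
pose O n : set (invariant_prob R p) := [set mu | P n (val mu)].
have oO n : open (O n).
  exists (P n) => //; case: n => [|n]; first exact: open_not_Lebesgue.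
  by rewrite /P; case: ifP => _; [exact: open_equidistributed|exact: open_recurrent].
have dO n : dense (O n).
  apply: shadow_dense => // nu nuI; case: n => [|n].
    exists 0 => // L0.
    by have [L [mu [? ? ? [? _]]]] := exists_rational_measure p2 q2 L0 nuI; exists L, mu.
  rewrite /P; case: ifP => _; first exact: exists_equidistributed_measure.
  exists 0 => // L0.
  by have [L [mu [? ? ? [_ ?]]]] := exists_rational_measure p2 q2 L0 nuI; exists L, mu.
exists (\bigcap_n O n).
  split; first by exists O.
  by apply: baire_invariant_prob => n; split.
move=> mu Omu.
have rec k : recurrent q k (val mu).
  by have := Omu k.*2.+1 I; rewrite /O/= /P odd_double doubleK.
have equi k : equidistributed q k (val mu).
  by have := Omu k.*2.+2 I; rewrite /O/= /P /= odd_double/= uphalf_double.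
split.
- exact: equidistributed_atomless equi.
- by apply: not_cvg_Lebesgue rec; exact: (Omu 0%N I).
- exact: equidistributed_upper_density equi.
Qed.
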